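(* Let $G(t)=\sum_{n\geq0}p_n t^n$, where $p_n$ is the probability that the simple random walk on the infinite Sierpiński graph started at the origin $o$ is at $o$ at time $n$ (equivalently, $G(4t)$ is the generating function of closed walks of length $n$ from $o$ to $o$). Then $G(t)$ is differentially transcendental over $\mathbb{C}(t)$.
   Context: The finite Sierpiński graphs are defined by $S_0$ = a single edge, and $S_{n+1}$ obtained from $S_n$ by replacing every edge (a segment) by a triangle of three half-size segments subdivided at their midpoints, i.e. $S_{n+1}$ consists of three copies of $S_n$ glued pairwise at corner vertices to form a triangle twice as large. Placing these graphs with a common corner $o$ so that $S_n\subset S_{n+1}$, and taking the union with its mirror image through $o$, one obtains the infinite Sierpiński graph, which is $4$-regular (every vertex, including $o$, has degree $4$). The simple random walk moves at each step to a uniformly chosen neighbour. Differentially transcendental over $\mathbb{C}(t)$: no nonzero polynomial $P$ over $\mathbb{C}(t)$ with $P(G,G',\dots,G^{(n)})=0$. *)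

(* Defs.v *)
From HB Require Import structures.
From mathcomp Require Import all_boot all_order all_algebra.
From mathcomp Require Import all_classical reals finmap.
From mathcomp Require Import complex.
(* Some notations of [mpoly] clash with those of [classical_sets]. *)
From mathcomp Require Import -(notations) mpoly.

Set Implicit Arguments.
Unset Strict Implicit.
Unset Printing Implicit Defensive.

Import Order.TTheory GRing.Theory Num.Theory.
Local Open Scope ring_scope.

Notation "{ 'mpoly' R [ n ] }" := (mpoly n R)
  (at level 0, R at level 2, n at level 2, format "{ 'mpoly'  R [ n ] }")
  : type_scope.

(* Formal power series K[[t]]; [Fps a] stands for \sum_n (a n) t^n. *)

Record fps (K : Type) : Type := Fps { fps_coef :> nat -> K }.

HB.instance Definition _ (K : Type) := [isNew for @fps_coef K].
HB.instance Definition _ (K : choiceType) := [Choice of fps K by <:].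

Lemma fpsP (K : Type) (f g : fps K) : f =1 g <-> f = g.
Proof.
by split=> [|->//]; case: f => f; case: g => g /= fg; congr Fps; exact: funext.
Qed.

Section FpsRing.
Variable K : fieldType.
Implicit Types f g h : fps K.

Definition fps_zero : fps K := Fps (fun=> 0).
Definition fps_opp f : fps K := Fps (fun n => - f n).
Definition fps_add f g : fps K := Fps (fun n => f n + g n).
Definition fps_one : fps K := Fps (fun n => (n == 0)%:R).
Definition fps_mul f g : fps K :=
  Fps (fun n => \sum_(i < n.+1) f i * g (n - i)%N).

Fact fps_addA : associative fps_add.
Proof. by move=> f g h; apply/fpsP => n /=; rewrite addrA. Qed.
Fact fps_addC : commutative fps_add.
Proof. by move=> f g; apply/fpsP => n /=; rewrite addrC. Qed.
Fact fps_add0 : left_id fps_zero fps_add.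
Proof. by move=> f; apply/fpsP => n /=; rewrite add0r. Qed.
Fact fps_addN : left_inverse fps_zero fps_opp fps_add.
Proof. by move=> f; apply/fpsP => n /=; rewrite addNr. Qed.

HB.instance Definition _ :=
  GRing.isZmodule.Build (fps K) fps_addA fps_addC fps_add0 fps_addN.

Fact fps_mulE f g n : fps_mul f g n = \sum_(i < n.+1) f i * g (n - i)%N.
Proof. by []. Qed.

Fact fps_mul_rev f g n : fps_mul f g n = \sum_(i < n.+1) f (n - i)%N * g i.
Proof.
rewrite /= (reindex_inj rev_ord_inj) /=.
by apply: eq_bigr => i _; rewrite subSS subKn // leq_ord.
Qed.

Fact fps_mulA : associative fps_mul.
Proof.
move=> f g h; apply/fpsP=> i; rewrite [LHS]fps_mulE [RHS]fps_mul_rev.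
pose coef3 j k := f j * (g (i - j - k)%N * h k).
transitivity (\sum_(j < i.+1) \sum_(k < i.+1 | (k <= i - j)%N) coef3 j k).
  apply: eq_bigr => j _.
  rewrite fps_mul_rev big_distrr /=.
  by rewrite (big_ord_narrow_leq (leq_subr _ _)).
rewrite (exchange_big_dep predT) //=; apply: eq_bigr => k _.
transitivity (\sum_(j < i.+1 | (j <= i - k)%N) coef3 j k).
  apply: eq_bigl => j; rewrite -ltnS -(ltnS j) -!subSn ?leq_ord //.
  by rewrite -subn_gt0 -(subn_gt0 j) -!subnDA addnC.
rewrite (big_ord_narrow_leq (leq_subr _ _)) big_distrl /=.
by apply: eq_bigr => j _; rewrite /coef3 -!subnDA addnC mulrA.
Qed.

Fact fps_mulC : commutative fps_mul.
Proof.
move=> f g; apply/fpsP => n; rewrite fps_mul_rev.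
by apply: eq_bigr => i _; rewrite mulrC.
Qed.

Fact fps_mul1 : left_id fps_one fps_mul.
Proof.
move=> f; apply/fpsP => n /=; rewrite big_ord_recl /= mul1r subn0.
by rewrite big1 ?addr0 // => i _; rewrite mul0r.
Qed.

Fact fps_mulDl : left_distributive fps_mul fps_add.
Proof.
move=> f g h; apply/fpsP => n /=; rewrite -big_split.
by apply: eq_bigr => i _; rewrite mulrDl.
Qed.

Fact fps_one_neq0 : fps_one != 0.
Proof.
by apply/eqP => /fpsP/(_ 0)/= /eqP; rewrite oner_eq0.
Qed.

HB.instance Definition _ := GRing.Zmodule_isComNzRing.Build (fps K)
  fps_mulA fps_mulC fps_mul1 fps_mulDl fps_one_neq0.

Definition fps_unit : pred (fps K) := fun f => `[< exists g, g * f = 1 >].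
Definition fps_inv f : fps K := xget f [set g | g * f = 1]%classic.

Fact fps_mulVf : {in fps_unit, left_inverse 1 fps_inv *%R}.
Proof. by move=> f /asboolP; apply: xgetPex. Qed.

Fact fps_unitP f g : g * f = 1 -> fps_unit f.
Proof. by move=> gf; apply/asboolP; exists g. Qed.

Fact fps_inv_out : {in [predC fps_unit], fps_inv =1 id}.
Proof.
move=> f /negP nf; rewrite /fps_inv; case: xgetP => // g _ gf.
by case: nf; exact: fps_unitP gf.
Qed.

HB.instance Definition _ := GRing.ComNzRing_hasMulInverse.Build (fps K)
  fps_mulVf fps_unitP fps_inv_out.

Lemma fps_ord f : f != 0 ->
  exists2 n, f n != 0 & forall i, (i < n)%N -> f i = 0.
Proof.
move=> f0; have exn : exists n, f n != 0.
  apply: contrapT => /forallNP nf; case/eqP: f0; apply/fpsP => n.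
  by apply/eqP/negPn/negP/nf.
case: (ex_minnP exn) => n fn minn; exists n => // i ltin; apply/eqP.
by apply: contraTT ltin => /minn; rewrite -leqNgt.
Qed.

Fact fps_integral f g : f * g = 0 -> (f == 0) || (g == 0).
Proof.
move=> fg0; apply/norP => -[/fps_ord[m fm lt_m] /fps_ord[n gn lt_n]].
have /eqP : (f * g) (m + n)%N = 0 by rewrite fg0.
rewrite [_ (m + n)%N]/= (bigD1 (inord m)) //= inordK ?ltnS ?leq_addr //.
rewrite addKn big1 ?addr0 ?mulf_eq0 ?(negPf fm) ?(negPf gn) // => i neq_im.
have [/lt_m->|lemi] := ltnP i m; first by rewrite mul0r.
have ltmi : (m < i)%N.
  rewrite ltn_neqAle lemi andbT; apply: contra neq_im => /eqP im.
  by apply/eqP/val_inj; rewrite /= inordK // ltnS leq_addr.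
rewrite (lt_n (m + n - i)%N) ?mulr0 // ltn_subLR ?ltn_add2r //.
exact: leq_ord.
Qed.

HB.instance Definition _ :=
  GRing.ComUnitRing_isIntegral.Build (fps K) fps_integral.

Definition fps_deriv f : fps K := Fps (fun n => f n.+1 *+ n.+1).

Definition fps_of_poly (p : {poly K}) : fps K := Fps (fun n => p`_n).

Fact fps_of_poly_zmod_morphism : zmod_morphism fps_of_poly.
Proof. by move=> p q; apply/fpsP => n; rewrite /= coefB. Qed.
Fact fps_of_poly_monoid_morphism : monoid_morphism fps_of_poly.
Proof.
by split=> [|p q]; apply/fpsP => n; rewrite /= ?coef1 ?coefM.
Qed.
HB.instance Definition _ :=
  GRing.isZmodMorphism.Build _ _ fps_of_poly fps_of_poly_zmod_morphism.
HB.instance Definition _ :=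
  GRing.isMonoidMorphism.Build _ _ fps_of_poly fps_of_poly_monoid_morphism.

Lemma fps_of_poly_inj : injective fps_of_poly.
Proof. by move=> p q /fpsP pq; apply/polyP => n; exact: pq. Qed.

Lemma fps_of_poly_eq0 p : (fps_of_poly p == 0) = (p == 0).
Proof. exact/raddf_eq0/fps_of_poly_inj. Qed.
End FpsRing.

Notation "x %:F" := (@FracField.tofrac _ x) : ring_scope.

(* The field of fractions of K[[t]] is the field K((t)) of Laurent series;
   [ratfun_laurent] is the inclusion of K(t) in K((t)). *)
Notation laurent K := {fraction (fps K)}.

Section RatfunLaurent.
Variable K : fieldType.

Definition ratfun_laurent (x : {fraction {poly K}}) : laurent K :=
  (fps_of_poly \n_(repr x))%:F / (fps_of_poly \d_(repr x))%:F.

Lemma frac_numden (R : idomainType) (x : {fraction R}) :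
  x = (\n_(repr x))%:F / (\d_(repr x))%:F.
Proof.
unlock FracField.tofrac; rewrite -[_^-1]FracField.pi_inv -[RHS]FracField.pi_mul.
rewrite /FracField.mulf /FracField.invf /=.
have d0 := denom_ratioP (repr x).
rewrite !numden_Ratio ?oner_neq0 // mulr1 mul1r Ratio_numden.
by rewrite reprK.
Qed.

Lemma ratfun_laurent_div (p q : {poly K}) : q != 0 ->
  ratfun_laurent (p%:F / q%:F) = (fps_of_poly p)%:F / (fps_of_poly q)%:F.
Proof.
move=> q0; rewrite /ratfun_laurent; set y := repr _.
have d0 : \d_y != 0 by exact: denom_ratioP.
have /esym := frac_numden (p%:F / q%:F); rewrite -/y => /eqP.
rewrite eqr_div ?tofrac_eq0 // -!rmorphM tofrac_eq => /eqP e.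
by apply/eqP; rewrite eqr_div ?tofrac_eq0 ?fps_of_poly_eq0 // -!rmorphM e.
Qed.

Fact ratfun_laurent_zmod_morphism : zmod_morphism ratfun_laurent.
Proof.
move=> x y; rewrite [in LHS](frac_numden x) [in LHS](frac_numden y).
have [dx dy] := (denom_ratioP (repr x), denom_ratioP (repr y)).
rewrite -mulNr addf_div ?tofrac_eq0 // -rmorphN -!rmorphM -rmorphD.
rewrite ratfun_laurent_div ?mulf_neq0 //.
rewrite !(rmorphM, rmorphD, rmorphN) /= -addf_div ?mulNr //;
  by rewrite tofrac_eq0 fps_of_poly_eq0.
Qed.

Fact ratfun_laurent_monoid_morphism : monoid_morphism ratfun_laurent.
Proof.
split=> [|x y].
  have := @ratfun_laurent_div 1 1 (oner_neq0 _).
  by rewrite !rmorph1 !divr1 => ->.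
rewrite [in LHS](frac_numden x) [in LHS](frac_numden y).
have [dx dy] := (denom_ratioP (repr x), denom_ratioP (repr y)).
rewrite mulf_div -!rmorphM ratfun_laurent_div ?mulf_neq0 //.
by rewrite !rmorphM /= -mulf_div.
Qed.

HB.instance Definition _ :=
  GRing.isZmodMorphism.Build _ _ ratfun_laurent ratfun_laurent_zmod_morphism.
HB.instance Definition _ := GRing.isMonoidMorphism.Build _ _ ratfun_laurent
  ratfun_laurent_monoid_morphism.

(* The value P(f, f', ..., f^(n)) in K((t)); the variable of index i stands
   for the i-th derivative. *)
Definition diff_eval n (P : {mpoly {fraction {poly K}}[n.+1]}) (f : fps K) :
    laurent K :=
  mmap ratfun_laurent (fun i : 'I_n.+1 => (iter i (@fps_deriv K) f)%:F) P.

Definition diff_transcendental (f : fps K) : Prop :=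
  ~ exists n, exists P : {mpoly {fraction {poly K}}[n.+1]},
      P != 0 /\ diff_eval P f = 0.

End RatfunLaurent.

(* Simple random walk on the graph with adjacency [adj], which should be locally
   finite: [fset_set] of an infinite set is empty. *)

Section SimpleRandomWalk.
Variables (R : realType) (V : choiceType) (adj : V -> V -> Prop).

Definition degree (x : V) : nat := #|` fset_set [set y | adj x y]%classic |.

Definition srw_step (x y : V) : R :=
  if `[< adj x y >] then (degree x)%:R^-1 else 0.

Fixpoint srw_prob (n : nat) (x y : V) : R :=
  if n is m.+1 then \sum_(z \in [set: V]%classic) srw_prob m x z * srw_step z y
  else (x == y)%:R.

End SimpleRandomWalk.

(* The graphs S_n are drawn in the lattice int * int, with the common corner
   o = (0, 0); S_n.+1 is a triangle with corners (0, 0), (2 ^ n, 0) and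
   (0, 2 ^ n), and edges in the directions (1, 0), (0, 1) and (1, -1). *)

Definition complete (vs : seq (int * int)) : rel (int * int) :=
  fun x y => [&& x != y, x \in vs & y \in vs].

Definition translate (v : int * int) (e : rel (int * int)) : rel (int * int) :=
  fun x y => e (x - v) (y - v).

Fixpoint sierpinski_fin (n : nat) : rel (int * int) :=
  match n with
  | 0 => complete [:: (0, 0); (1, 0)]
  | 1 => complete [:: (0, 0); (1, 0); (0, 1)]
  | (k.+1 as m).+1 => fun x y =>
      [|| sierpinski_fin m x y,
          translate ((2 ^ k)%N%:Z, 0) (sierpinski_fin m) x y
        | translate (0, (2 ^ k)%N%:Z) (sierpinski_fin m) x y]
  end.

(* The mirror image through o is x |-> - x. *)
Definition sierpinski (x y : int * int) : Prop :=
  exists n, sierpinski_fin n x y \/ sierpinski_fin n (- x) (- y).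

Definition return_prob (R : realType) (n : nat) : R :=
  srw_prob R sierpinski n (0, 0) (0, 0).

Definition return_gf (R : realType) : fps R[i] :=
  Fps (fun n => (return_prob R n)%:C%C).

(* Main.v *)
(* Write [t] for the variable and [d(t) = t^2 / (4 - 3 t)].  Eliminating the
   midpoints of the triangles of side 2 from the equation of the Green function
   [g_x(t) = \sum_n P(X_n = x) t^n] shows that [x |-> g_(2 x)] is, up to a
   factor, a Green function at time [d(t)]; Green functions being unique, this
   yields [G = f G(d)] with [f = (4 + t) (2 - t) / ((2 + t) (4 - 3 t))].

   The substitution [s : h |-> h(d)] acts on [y_i = G^(i) / G] by an affine
   triangular transformation with rational coefficients.  An algebraic relation
   between [G, y_1, ..., y_N] over C(t) with minimal leading monomial is thus
   mapped by [s] to a multiple of itself.  Taking partial derivatives of such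
   a semi-invariant, and using that its top coefficient is a semi-invariant in
   fewer variables, one reaches a rational solution [u] of
   [u = d' u(d) - k f'/f - m d''/d'] with constants [(k, m) != (0, 0)].  In the
   coordinate [v = 4/t], [d] becomes the polynomial [v^2 - 3 v] and, up to a
   coboundary, the right-hand side has its poles at 1 and at the critical point
   3/2 only, so that the set of poles of [u] would be stable under taking
   preimages along an infinite backward orbit of real numbers. *)

From HB Require Import structures.
Require Import Defs.
From mathcomp Require Import all_boot all_order all_algebra.
From mathcomp Require Import reals complex.
From mathcomp Require Import -(notations) finmap all_classical.
From mathcomp Require Import mpoly.
From mathcomp Require Import ring lra zify.

Set Implicit Arguments.
Unset Strict Implicit.
Unset Printing Implicit Defensive.
Import Order.TTheory GRing.Theory Num.Theory.
Local Open Scope ring_scope.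

(** * Extension of morphisms and derivations to fields of fractions *)

(** In the coordinate [v = 4/t] the superattracting point [t = 0] of [d] moves to infinity, which is
    why [d] becomes a polynomial; the repelling fixed point [t = 1] becomes [v = 4], the limit of
    the backward orbit. The variable of index [N] stands for [G] and that of index [N - j] for
    [y_j]: higher derivatives are then larger in the monomial order, and the substitution preserves
    leading monomials. The integer [m] is a binomial coefficient: up to a power of [d'], the
    coefficient of [y_(k-1)] in the image of [y_k] is [- (k f'/f + C(k,2) d''/d')]. The coboundary
    has the following origin. Write [q = v^2 - 3 v], so that [q - 4 = (v - 4)(v + 1)],
    [q + 2 = (v - 1)(v - 2)] and [q = v (v - 3)]. With [g = (v - 4)(v + 2)/v] this gives
    [f = g(q) / ((v - 1) g)], while [d' = (2 v - 3) v^2 / q^2]. Modulo coboundaries, the logarithmic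
    derivatives of [f] and [d'] thus reduce to those of [1/(v - 1)] and [2 v - 3]. *)

Section FracExtension.
Variables (R : idomainType) (F : fieldType) (phi : {rmorphism R -> F}).

(** Injectivity of [phi] keeps denominators nonzero; with its proof as an argument, the ring
    morphism structure can be attached to the term itself. *)
Definition frac_ext of injective phi := fun x : {fraction R} =>
  phi \n_(repr x) / phi \d_(repr x).

Hypothesis phi_inj : injective phi.
Local Notation ext := (frac_ext phi_inj).

Let phi_neq0 a : a != 0 -> phi a != 0.
Proof. by rewrite raddf_eq0. Qed.

Lemma frac_ext_div a b : b != 0 -> ext (a%:F / b%:F) = phi a / phi b.
Proof.
move=> b0; rewrite /frac_ext; set y := repr _.
have d0 : \d_y != 0 by exact: denom_ratioP.
have /esym := frac_numden (a%:F / b%:F); rewrite -/y => /eqP.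
rewrite eqr_div ?tofrac_eq0 // -!rmorphM tofrac_eq => /eqP e.
by apply/eqP; rewrite eqr_div ?phi_neq0 // -!rmorphM e.
Qed.

Fact frac_ext_zmod_morphism : zmod_morphism ext.
Proof.
move=> x y; rewrite [in LHS](frac_numden x) [in LHS](frac_numden y).
have [dx dy] := (denom_ratioP (repr x), denom_ratioP (repr y)).
rewrite -mulNr addf_div ?tofrac_eq0 // -rmorphN -!rmorphM -rmorphD.
rewrite frac_ext_div ?mulf_neq0 //.
by rewrite !(rmorphM, rmorphD, rmorphN) /= -addf_div ?mulNr ?phi_neq0.
Qed.

Fact frac_ext_monoid_morphism : monoid_morphism ext.
Proof.
split=> [|x y].
  by have := @frac_ext_div 1 1 (oner_neq0 _); rewrite !rmorph1 !divr1.
rewrite [in LHS](frac_numden x) [in LHS](frac_numden y).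
have [dx dy] := (denom_ratioP (repr x), denom_ratioP (repr y)).
rewrite mulf_div -!rmorphM frac_ext_div ?mulf_neq0 //.
by rewrite !rmorphM /= -mulf_div.
Qed.

HB.instance Definition _ :=
  GRing.isZmodMorphism.Build _ _ ext frac_ext_zmod_morphism.
HB.instance Definition _ :=
  GRing.isMonoidMorphism.Build _ _ ext frac_ext_monoid_morphism.

Lemma frac_ext_tofrac a : ext a%:F = phi a.
Proof.
by have := @frac_ext_div a 1 (oner_neq0 _); rewrite !rmorph1 !divr1.
Qed.
End FracExtension.

(** For [n / d = a / b] the quotient rule gives the same value on both fractions. The factor [b * d]
    allows the cross-multiplied equality and its derivative to be substituted inside a ring; it is
    cancelled afterwards. *)
Lemma quotient_rule_well_defined (R : comNzRingType) (n d a b n' d' a' b' : R) :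
  n * b = a * d -> n' * b + n * b' = a' * d + a * d' ->
  b * (d * ((n' * d - n * d') * b ^+ 2)) =
  b * (d * ((a' * b - a * b') * d ^+ 2)).
Proof.
move=> e e'.
transitivity (d * b ^+ 2 * (n' * b + n * b') * d
  - d * b ^+ 2 * (n * b) * d' - d ^+ 2 * b ^+ 2 * n * b'); first by ring.
rewrite e' e.
transitivity (d * b ^+ 2 * (a' * d + a * d') * d
  - d * b ^+ 2 * (a * d) * d' - d ^+ 2 * b * (n * b) * b'); first by ring.
by rewrite e; ring.
Qed.

Lemma quotient_ruleM (F : fieldType) (a b c d a' b' c' d' : F) :
  b != 0 -> d != 0 ->
  ((a' * c + a * c') * (b * d) - a * c * (b' * d + b * d')) / (b * d) ^+ 2 =
  (a' * b - a * b') / b ^+ 2 * (c / d) + a / b * ((c' * d - c * d') / d ^+ 2).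
Proof. by move=> b0 d0; field; rewrite b0 d0. Qed.

Lemma quotient_ruleD (F : fieldType) (a b c d a' b' c' d' : F) :
  b != 0 -> d != 0 ->
  ((a' * d + a * d' + (c' * b + c * b')) * (b * d) -
    (a * d + c * b) * (b' * d + b * d')) / (b * d) ^+ 2 =
  (a' * b - a * b') / b ^+ 2 + (c' * d - c * d') / d ^+ 2.
Proof. by move=> b0 d0; field; rewrite b0 d0. Qed.

Section FracDerivation.
Variables (R : idomainType) (der : {additive R -> R}).
Hypothesis derM : forall x y, der (x * y) = der x * y + x * der y.

Definition frac_der (x : {fraction R}) : {fraction R} :=
  let n := \n_(repr x) in let d := \d_(repr x) in
  (der n * d - n * der d)%:F / (d ^+ 2)%:F.

Lemma frac_der_div a b : b != 0 ->
  frac_der (a%:F / b%:F) = (der a * b - a * der b)%:F / (b ^+ 2)%:F.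
Proof.
move=> b0; rewrite /frac_der; set y := repr _.
have d0 : \d_y != 0 by exact: denom_ratioP.
have /esym := frac_numden (a%:F / b%:F); rewrite -/y => /eqP.
rewrite eqr_div ?tofrac_eq0 // -!rmorphM tofrac_eq => /eqP e.
apply/eqP; rewrite eqr_div ?tofrac_eq0 ?expf_neq0 // -!rmorphM tofrac_eq.
have e' : der \n_y * b + \n_y * der b = der a * \d_y + a * der \d_y.
  by rewrite -!derM e.
apply/eqP/(mulfI d0)/(mulfI b0); exact: quotient_rule_well_defined.
Qed.

Lemma frac_derM x y : frac_der (x * y) = frac_der x * y + x * frac_der y.
Proof.
rewrite [x]frac_numden [y]frac_numden.
have [dx dy] := (denom_ratioP (repr x), denom_ratioP (repr y)).
move: (\n_(repr x)) (\d_(repr x)) (\n_(repr y)) (\d_(repr y)) dx dy.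
move=> {x y} a b c d b0 d0.
rewrite mulf_div -!rmorphM !frac_der_div ?mulf_neq0 // !derM.
rewrite !(rmorphXn, rmorphM, rmorphD, rmorphN) /=.
by apply: quotient_ruleM; rewrite tofrac_eq0.
Qed.

Lemma frac_derD x y : frac_der (x + y) = frac_der x + frac_der y.
Proof.
rewrite [x]frac_numden [y]frac_numden.
have [dx dy] := (denom_ratioP (repr x), denom_ratioP (repr y)).
move: (\n_(repr x)) (\d_(repr x)) (\n_(repr y)) (\d_(repr y)) dx dy.
move=> {x y} a b c d b0 d0.
have b0' : b%:F != 0 by rewrite tofrac_eq0.
have d0' : d%:F != 0 by rewrite tofrac_eq0.
rewrite addf_div // -!rmorphM -rmorphD !frac_der_div ?mulf_neq0 //.
rewrite (raddfD der) !derM.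
rewrite !(rmorphXn, rmorphM, rmorphD, rmorphN) /=.
exact: quotient_ruleD.
Qed.

Lemma frac_der_tofrac a : frac_der a%:F = (der a)%:F.
Proof.
have d1 : der 1 = 0.
  have := derM 1 1; rewrite mulr1 mul1r mulr1 => /eqP.
  by rewrite eq_sym -subr_eq0 addrK => /eqP.
have := @frac_der_div a 1 (oner_neq0 _).
by rewrite d1 !rmorph1 divr1 mulr1 mulr0 subr0 expr1n rmorph1 divr1.
Qed.
End FracDerivation.

(** * Derivation and composition of power series *)

Section FpsDerivation.
Variable K : fieldType.
Implicit Types f g h : fps K.

Lemma fps_coefD f g n : (f + g) n = f n + g n. Proof. by []. Qed.
Lemma fps_coefN f n : (- f) n = - f n. Proof. by []. Qed.
Lemma fps_coef0 n : (0 : fps K) n = 0. Proof. by []. Qed.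
Lemma fps_coef1 n : (1 : fps K) n = (n == 0)%:R. Proof. by []. Qed.
Lemma fps_coefM f g n : (f * g) n = \sum_(i < n.+1) f i * g (n - i)%N.
Proof. by []. Qed.

Lemma fps_coef_sum (I : Type) (r : seq I) (P : pred I) (F : I -> fps K) n :
  (\sum_(i <- r | P i) F i) n = \sum_(i <- r | P i) F i n.
Proof. by elim/big_rec2: _ => // i x y _ <-. Qed.

Definition fps_cst (c : K) : fps K := fps_of_poly c%:P.

Fact fps_cst_zmod_morphism : zmod_morphism fps_cst.
Proof. by move=> x y; rewrite /fps_cst !raddfB. Qed.
Fact fps_cst_monoid_morphism : monoid_morphism fps_cst.
Proof. by split=> [|x y]; rewrite /fps_cst ?rmorph1 ?rmorphM. Qed.
HB.instance Definition _ :=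
  GRing.isZmodMorphism.Build _ _ fps_cst fps_cst_zmod_morphism.
HB.instance Definition _ :=
  GRing.isMonoidMorphism.Build _ _ fps_cst fps_cst_monoid_morphism.

Lemma fps_cstM c f n : (fps_cst c * f) n = c * f n.
Proof.
rewrite fps_coefM big_ord_recl /= coefC eqxx subn0 big1 ?addr0 // => i _.
by rewrite coefC /= mul0r.
Qed.

Lemma fps_deriv_zmod_morphism : zmod_morphism (@fps_deriv K).
Proof. by move=> f g; apply/fpsP => n /=; rewrite mulrnBl. Qed.
HB.instance Definition _ :=
  GRing.isZmodMorphism.Build _ _ (@fps_deriv K) fps_deriv_zmod_morphism.

Lemma fps_deriv_poly (p : {poly K}) :
  fps_deriv (fps_of_poly p) = fps_of_poly p^`().
Proof. by apply/fpsP => n; rewrite /= coef_deriv. Qed.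

Lemma fps_coefM_eq f g f' g' n :
  (forall i, (i <= n)%N -> f i = f' i) -> (forall i, (i <= n)%N -> g i = g' i) ->
  (f * g) n = (f' * g') n.
Proof.
move=> ff gg; rewrite !fps_coefM; apply: eq_bigr => i _.
by rewrite ff ?leq_ord // gg ?leq_subr.
Qed.

Definition fps_trunc N f : {poly K} := \poly_(i < N) f i.

Lemma fps_truncE N f n : (n < N)%N -> (fps_trunc N f)`_n = f n.
Proof. by move=> nN; rewrite coef_poly nN. Qed.

(** The coefficient of index [n] only involves coefficients of index at most [n + 1], so truncation
    reduces the rule to the one for polynomials. *)
Lemma fps_derivM f g :
  fps_deriv (f * g) = fps_deriv f * g + f * fps_deriv g.
Proof.
apply/fpsP => n; pose p := fps_trunc n.+2 f; pose q := fps_trunc n.+2 g.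
have pE i : (i <= n.+1)%N -> f i = fps_of_poly p i.
  by move=> ile; rewrite /= fps_truncE.
have qE i : (i <= n.+1)%N -> g i = fps_of_poly q i.
  by move=> ile; rewrite /= fps_truncE.
have -> : fps_deriv (f * g) n = fps_deriv (fps_of_poly (p * q)) n.
  have := fps_coefM_eq pE qE; rewrite -rmorphM.
  exact: (congr1 (fun x => x *+ n.+1)).
have -> : fps_deriv (fps_of_poly (p * q)) =
    fps_deriv (fps_of_poly p) * fps_of_poly q +
    fps_of_poly p * fps_deriv (fps_of_poly q).
  by rewrite !fps_deriv_poly derivM rmorphD !rmorphM.
rewrite !fps_coefD; congr (_ + _); apply: fps_coefM_eq => i ile;
  by rewrite /= fps_truncE // ?ltnS // ltnW.
Qed.
End FpsDerivation.

Section FpsComposition.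
Variables (K : fieldType) (d : fps K).
Hypothesis d0 : d 0 = 0.
Implicit Types f g : fps K.

(** Since [d 0 = 0], the power [d ^+ k] has no coefficient of index below [k], so the finite sum is
    the full composition. *)
Definition fps_comp of d 0 = 0 := fun f =>
  Fps (fun n => \sum_(k < n.+1) f k * (d ^+ k) n).
Local Notation comp := (fps_comp d0).

Lemma fps_exp_coef0 k n : (n < k)%N -> (d ^+ k) n = 0.
Proof.
elim: k n => // k IH n nk; rewrite exprS fps_coefM big1 // => -[[|i] ilt] _ /=.
  by rewrite d0 mul0r.
by rewrite IH ?mulr0 // ltn_subLR // addSn ltnS (@leq_trans k) ?leq_addl.
Qed.

Lemma sum_ord_trunc (V : nmodType) (F : nat -> V) n N :
  (forall k, (n <= k)%N -> F k = 0) -> (n <= N)%N ->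
  \sum_(k < N) F k = \sum_(k < n) F k.
Proof.
move=> F0 nN; rewrite -!(big_mkord xpredT) (big_cat_nat (leq0n n) nN) //=.
by rewrite [X in _ + X]big_nat_cond [X in _ + X]big1 ?addr0 // => k /andP[/andP[/F0]].
Qed.

Definition fps_horner (p : {poly K}) : fps K := (map_poly (@fps_cst K) p).[d].

Fact fps_horner_zmod_morphism : zmod_morphism fps_horner.
Proof. by move=> p q; rewrite /fps_horner rmorphB hornerD hornerN. Qed.
Fact fps_horner_monoid_morphism : monoid_morphism fps_horner.
Proof.
by split=> [|p q]; rewrite /fps_horner ?rmorph1 ?hornerC // rmorphM hornerM.
Qed.
HB.instance Definition _ :=
  GRing.isZmodMorphism.Build _ _ fps_horner fps_horner_zmod_morphism.
HB.instance Definition _ :=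
  GRing.isMonoidMorphism.Build _ _ fps_horner fps_horner_monoid_morphism.

Lemma fps_hornerE p n :
  fps_horner p n = \sum_(k < n.+1) p`_k * (d ^+ k) n.
Proof.
have le : (size (map_poly (@fps_cst K) p) <= maxn n.+1 (size p))%N.
  by rewrite leq_max size_poly orbT.
rewrite /fps_horner (horner_coef_wide _ le) fps_coef_sum.
under eq_bigr => i _ do rewrite coef_map [_ n]fps_cstM.
apply: (sum_ord_trunc (F := fun k => p`_k * (d ^+ k) n)); last exact: leq_maxl.
by move=> k lt; rewrite fps_exp_coef0 ?mulr0.
Qed.

(** Up to a given order, composition is Horner evaluation of a polynomial; multiplicativity and the
    chain rule are transported from there. *)
Lemma fps_comp_trunc f n N : (n < N)%N ->
  comp f n = fps_horner (fps_trunc N f) n.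
Proof.
move=> nN; rewrite fps_hornerE /=; apply: eq_bigr => k _.
by rewrite fps_truncE // (leq_trans (ltn_ord k)).
Qed.

Lemma fps_comp_zmod_morphism : zmod_morphism comp.
Proof.
move=> f g; apply/fpsP => n /=; rewrite -sumrB.
by apply: eq_bigr => i _; rewrite mulrBl.
Qed.

Lemma fps_comp_monoid_morphism : monoid_morphism comp.
Proof.
split=> [|f g]; apply/fpsP => n.
  rewrite [LHS]/= big_ord_recl /= mul1r big1 ?addr0 // => i _.
  by rewrite mul0r.
transitivity (fps_horner (fps_trunc n.+1 f * fps_trunc n.+1 g) n); last first.
  rewrite rmorphM; apply: fps_coefM_eq => i ile;
    by rewrite (fps_comp_trunc _ (_ : i < n.+1)%N).
rewrite fps_hornerE [LHS]/=; apply: eq_bigr => k _; congr (_ * _).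
rewrite coefM; apply: eq_bigr => i _.
have [kn ik] : (k < n.+1 /\ i < k.+1)%N by split.
rewrite !fps_truncE ?(leq_ltn_trans (leq_subr _ _)) //.
exact: leq_trans ik kn.
Qed.

HB.instance Definition _ :=
  GRing.isZmodMorphism.Build _ _ comp fps_comp_zmod_morphism.
HB.instance Definition _ :=
  GRing.isMonoidMorphism.Build _ _ comp fps_comp_monoid_morphism.

Lemma fps_comp_poly p : comp (fps_of_poly p) = fps_horner p.
Proof. by apply/fpsP => n; rewrite fps_hornerE. Qed.

Lemma fps_deriv_horner p :
  fps_deriv (fps_horner p) = fps_deriv d * fps_horner p^`().
Proof.
elim/poly_ind: p => [|p c IH]; first by rewrite deriv0 !raddf0 mulr0.
have hX : fps_horner 'X = d by rewrite /fps_horner map_polyX hornerX.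
have hC : fps_horner c%:P = fps_cst c by rewrite /fps_horner map_polyC hornerC.
have hS : fps_horner (p * 'X + c%:P) = fps_horner p * d + fps_cst c.
  by rewrite rmorphD rmorphM /= hX hC.
have dC : fps_deriv (fps_cst c) = 0 by rewrite fps_deriv_poly derivC raddf0.
rewrite hS raddfD /= fps_derivM IH [fps_deriv (fps_cst c)]dC addr0.
rewrite derivD derivM derivC derivX addr0 mulr1 rmorphD rmorphM /= hX.
by rewrite mulrDr mulrA (mulrC (fps_horner p)).
Qed.

Lemma fps_deriv_comp f : fps_deriv (comp f) = fps_deriv d * comp (fps_deriv f).
Proof.
apply/fpsP => n.
transitivity (fps_deriv (fps_horner (fps_trunc n.+2 f)) n).
  by rewrite [LHS]/= [RHS]/= -(fps_comp_trunc f (ltnSn n.+1)).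
rewrite fps_deriv_horner; apply: fps_coefM_eq => // i ile.
rewrite fps_hornerE [RHS]/=; apply: eq_bigr => k _.
rewrite coef_deriv fps_truncE // !ltnS.
by apply: leq_trans ile; rewrite leq_ord.
Qed.

Lemma fps_comp_inj m : d m.+1 != 0 -> (forall i, (i < m.+1)%N -> d i = 0) ->
  injective comp.
Proof.
move=> dm dlt; apply: raddf_inj => f.
have val k : (d ^+ k) (k * m.+1)%N = d m.+1 ^+ k /\
    forall i, (i < k * m.+1)%N -> (d ^+ k) i = 0.
  elim: k => [|k [IH0 IH]]; first by rewrite expr0 mul0n.
  split=> [|i ik].
    have lt : (m.+1 < (k.+1 * m.+1).+1)%N by rewrite ltnS leq_pmull.
    rewrite exprS fps_coefM (bigD1 (Ordinal lt)) //= big1 => [|j nj].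
      by rewrite addr0 mulSn addKn IH0 exprS.
    have [jm|jm|jm] := ltngtP j m.+1; first by rewrite dlt ?mul0r.
      by rewrite IH ?mulr0 // ltn_subLR ?leq_ord // [X in (X < _)%N]mulSn ltn_add2r.
    by case/eqP: nj; apply: val_inj.
  rewrite exprS fps_coefM big1 // => j _.
  have [jm|jm] := ltnP j m.+1; first by rewrite dlt ?mul0r.
  rewrite IH ?mulr0 // ltn_subLR ?leq_ord //.
  by apply: leq_trans ik _; rewrite mulSn leq_add2r.
move=> fc; apply/eqP; apply: contraT => /fps_ord[n fn flt].
have /fpsP/(_ (n * m.+1)%N)/eqP := fc.
have lt : (n < (n * m.+1).+1)%N by rewrite ltnS leq_pmulr.
rewrite [_ (_ * _)%N]/= (bigD1 (Ordinal lt)) //= (val n).1 big1 => [|j nj].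
  by rewrite addr0 mulf_eq0 expf_eq0 (negPf fn) (negPf dm) andbF.
have [jn|jn|jn] := ltngtP j n; first by rewrite flt ?mul0r.
  by rewrite (val j).2 ?mulr0 // ltn_pmul2r.
by case/eqP: nj; apply: val_inj.
Qed.
End FpsComposition.

(** * Affine substitutions in polynomial rings *)

Section AffineSubstitution.
Variables (K : fieldType) (sg : {rmorphism K -> K}) (n : nat).
Variables (A : 'I_n -> 'I_n -> K) (e : 'I_n -> K).
Implicit Types P Q : {mpoly K[n]}.

Definition affine_form (i : 'I_n) : {mpoly K[n]} :=
  \sum_k A i k *: 'X_k + (e i)%:MP.

Definition affine_subst : {mpoly K[n]} -> {mpoly K[n]} :=
  mmap (@mpolyC n K \o sg) affine_form.

#[local] Arguments affine_subst : simpl never.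

Fact affine_subst_zmod_morphism : zmod_morphism affine_subst.
Proof. by move=> P Q; rewrite /affine_subst rmorphB. Qed.
Fact affine_subst_monoid_morphism : monoid_morphism affine_subst.
Proof. by split=> [|P Q]; rewrite /affine_subst ?rmorph1 ?rmorphM. Qed.
HB.instance Definition _ :=
  GRing.isZmodMorphism.Build _ _ affine_subst affine_subst_zmod_morphism.
HB.instance Definition _ :=
  GRing.isMonoidMorphism.Build _ _ affine_subst affine_subst_monoid_morphism.
Local Notation tau := affine_subst.

Lemma affine_substC c : tau c%:MP = (sg c)%:MP.
Proof. exact: mmapC. Qed.

Lemma affine_substX i : tau 'X_i = affine_form i.
Proof. by rewrite /tau mmapX mmap1U. Qed.

Lemma affine_substZ c Q : tau (c *: Q) = sg c *: tau Q.
Proof. by rewrite -!mul_mpolyC rmorphM /= affine_substC. Qed.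

Lemma mderivXU (i j : 'I_n) : ('X_j : {mpoly K[n]})^`M(i) = (j == i)%:R%:MP.
Proof.
rewrite mderivX mnm1E; case: eqP => [->|_]; last by rewrite scale0r mpolyC0.
have -> : (U_(i) - U_(i) = 0)%MM by apply/mnmP => k; rewrite mnmBE mnm0E subnn.
by rewrite mpolyX0 scale1r mpolyC1.
Qed.

Lemma mderiv_affine_form i j : (affine_form j)^`M(i) = (A j i)%:MP.
Proof.
rewrite mderivD mderivC addr0 raddf_sum (bigD1 i) //= mderivZ mderivXU eqxx.
rewrite -mul_mpolyC -mpolyCM mulr1 big1 ?addr0 // => k ki.
by rewrite mderivZ mderivXU (negPf ki) -mul_mpolyC mpolyC0 mulr0.
Qed.

Lemma mpoly_gen_ind (S : {mpoly K[n]} -> Prop) :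
  (forall c, S c%:MP) -> (forall i, S 'X_i) ->
  (forall P Q, S P -> S Q -> S (P + Q)) ->
  (forall P Q, S P -> S Q -> S (P * Q)) -> forall P, S P.
Proof.
move=> SC SX SD SM P; rewrite (mpolyE P).
apply: (big_ind S) => [||m _]; [by rewrite -mpolyC0|exact: SD|].
rewrite -mul_mpolyC; apply: (SM) => //; rewrite mpolyXE_id.
apply: (big_ind S) => [||i _]; [by rewrite -mpolyC1|exact: SM|].
by elim: (m i) => [|k IH]; rewrite ?expr0 ?exprS -?mpolyC1 //; exact: SM.
Qed.

Lemma mderiv_affine_subst i Q :
  (tau Q)^`M(i) = \sum_j A j i *: tau Q^`M(j).
Proof.
elim/mpoly_gen_ind: Q => [c|k|P Q IP IQ|P Q IP IQ].
- rewrite affine_substC mderivC big1 // => j _.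
  by rewrite mderivC rmorph0 scaler0.
- rewrite affine_substX mderiv_affine_form (bigD1 k) //= mderivXU eqxx.
  rewrite mpolyC1 rmorph1 -mul_mpolyC mulr1 big1 ?addr0 // => j jk.
  by rewrite mderivXU eq_sym (negPf jk) mpolyC0 rmorph0 scaler0.
- rewrite rmorphD mderivD IP IQ -big_split; apply: eq_bigr => j _.
  by rewrite mderivD rmorphD scalerDr.
- rewrite rmorphM mderivM IP IQ mulr_suml mulr_sumr -big_split.
  apply: eq_bigr => j _; rewrite mderivM rmorphD !rmorphM scalerDr.
  by rewrite scalerAl scalerAr.
Qed.

Hypothesis A_triangular : forall i k : 'I_n, (k < i)%N -> A i k = 0.
Hypothesis A_diag : forall i, A i i != 0.

(** A variable of smaller index is larger in the monomial order; this is what turns the triangular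
    shape of [A] into preservation of leading monomials. *)
Lemma ltmU (i k : 'I_n) : (i < k)%N -> (U_(k)%MM < U_(i)%MM)%O.
Proof.
move=> ik; apply/ltmcP; first by rewrite !mdeg1.
exists i => [j ji|]; rewrite !mnm1E -!val_eqE /= ?eqxx ?(gtn_eqF ik) //.
by rewrite (gtn_eqF ji) (gtn_eqF (ltn_trans ji ik)).
Qed.

Lemma mcoeff_affine_form i m : (affine_form i)@_m =
  \sum_k A i k * (U_(k)%MM == m)%:R + e i * (m == 0%MM)%:R.
Proof.
rewrite mcoeffD mcoeffC raddf_sum /=; congr (_ + _); apply: eq_bigr => k _.
by rewrite mcoeffZ mcoeffX.
Qed.

Lemma mcoeff_affine_formU i : (affine_form i)@_U_(i) = A i i.
Proof.
rewrite mcoeff_affine_form (bigD1 i) //= eqxx mulr1 mnm1_eq0 mulr0 addr0.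
rewrite big1 ?addr0 // => k ki; rewrite (_ : _ == _ = false) ?mulr0 //.
apply/negbTE; apply: contraNneq ki => /mnmP/(_ i); rewrite !mnm1E eqxx.
by case: eqP.
Qed.

Lemma affine_form_neq0 i : affine_form i != 0.
Proof.
by apply: contraNneq (A_diag i) => F0; rewrite -mcoeff_affine_formU F0 mcoeff0.
Qed.

Lemma mlead_affine_form i : mlead (affine_form i) = U_(i)%MM.
Proof.
apply/eqP; rewrite eq_le msupp_le_mlead ?mcoeff_msupp ?mcoeff_affine_formU //.
rewrite andbT leNgt; apply/negP => lt.
have := mlead_supp (affine_form_neq0 i); rewrite mcoeff_msupp => /eqP[].
rewrite mcoeff_affine_form big1 => [|k _].
  rewrite add0r; case: eqP lt => [->|]; last by rewrite mulr0.
  by have := lemc_addr 0%MM U_(i)%MM; rewrite add0m leNgt => /negbTE->.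
case: eqP => [kl|]; last by rewrite mulr0.
rewrite -kl in lt; rewrite A_triangular ?mul0r // ltnNge.
rewrite leq_eqVlt; apply/negP => /orP[/eqP/val_inj ki|/ltmU/lt_trans].
  by rewrite ki ltxx in lt.
by move/(_ _ lt); rewrite ltxx.
Qed.

Lemma mlead_affine_substX m : mlead (tau 'X_[m]) = m.
Proof.
rewrite /tau mmapX /mmap1 mlead_prod; last first.
  by move=> i _ _; rewrite expf_neq0 ?affine_form_neq0.
rewrite [RHS]multinomUE_id; apply: eq_bigr => i _.
by rewrite mleadX ?affine_form_neq0 // mlead_affine_form.
Qed.

(** The image of a monomial below [m] has its leading monomial below [m], so only the term of [Q] at
    [m] contributes. *)
Lemma mcoeff_affine_subst_lead Q m : (mlead Q <= m)%O ->
  (tau Q)@_m = sg Q@_m * (tau 'X_[m])@_m.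
Proof.
move=> le; have -> : (tau Q)@_m = \sum_(m' <- msupp Q) sg Q@_m' * (tau 'X_[m'])@_m.
  rewrite {1}(mpolyE Q) (@rmorph_sum _ _ tau) (@raddf_sum _ _ (mcoeff m)) /=.
  by apply: eq_bigr => m' _; rewrite affine_substZ mcoeffZ.
have tz m' : (m' < m)%O -> (tau 'X_[m'])@_m = 0.
  by move=> lt; rewrite mcoeff_gt_mlead // mlead_affine_substX.
case: (boolP (m \in msupp Q)) => [mQ|mQ]; last first.
  have := mQ; rewrite mcoeff_msupp negbK => /eqP ->.
  rewrite rmorph0 mul0r big_seq big1 // => m' m'Q.
  rewrite tz ?mulr0 // lt_neqAle (le_trans (msupp_le_mlead m'Q)) // andbT.
  by apply: contraNneq mQ => <-.
rewrite (bigD1_seq m) ?msupp_uniq //= addrC big_seq_cond big1 ?add0r // => m' /andP[m'Q m'm].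
by rewrite tz ?mulr0 // lt_neqAle m'm (le_trans (msupp_le_mlead m'Q)).
Qed.

Definition semi_invariant Q := exists c, tau Q = c *: Q.

(* A relation with minimal leading monomial is unique up to scaling, while
   [tau] preserves both the relations and the leading monomials. *)
Lemma exists_semi_invariant (L : comNzRingType)
    (ev : {rmorphism {mpoly K[n]} -> L}) :
  (forall Q, ev Q = 0 -> ev (tau Q) = 0) ->
  (exists2 Q, Q != 0 & ev Q = 0) ->
  exists Q, [/\ Q != 0, ev Q = 0 & semi_invariant Q].
Proof.
move=> ev_tau [Q0 Q00 evQ0].
move: {2}(mlead Q0) (erefl (mlead Q0)) => m; move: m Q0 Q00 evQ0.
elim/(ltmwf (n := n)) => m IH Q Qn0 evQ lQ.
have q0 : Q@_m != 0 by rewrite -lQ mleadc_eq0.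
(* This [c] cancels the coefficients at [m]: [P] is either zero or a relation with smaller leading
   monomial. *)
pose c := (tau Q)@_m / Q@_m; pose P := tau Q - c *: Q.
have [P0|P0] := eqVneq P 0.
  by exists Q; split=> //; exists c; apply/eqP; rewrite -subr_eq0 -/P P0.
apply: (IH (mlead P) _ P P0 _ erefl); last first.
  by rewrite rmorphB -mul_mpolyC rmorphM /= evQ mulr0 subr0 ev_tau.
rewrite ltNge; apply/negP => le.
have := mlead_supp P0; rewrite mcoeff_msupp => /eqP[].
rewrite mcoeffB mcoeffZ; move: le; rewrite le_eqVlt => /orP[/eqP<-|lt].
  by rewrite divfK // subrr.
rewrite mcoeff_affine_subst_lead ?lQ 1?ltW //.
by rewrite [Q@_ _]mcoeff_gt_mlead ?lQ // rmorph0 mul0r mulr0 subr0.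
Qed.

Hypothesis char0 : forall k, k.+1%:R != 0 :> K.

Lemma mpoly_mderiv_eq0 Q : (forall i, Q^`M(i) = 0) -> Q = (Q@_0%MM)%:MP.
Proof.
move=> Q0; apply/mpolyP => m; rewrite mcoeffC.
case: eqP => [->|m0]; rewrite ?mulr1 ?mulr0 //.
have [i mi] : exists i, m i != 0%N.
  apply/existsP; apply: contra_notT m0; rewrite negb_exists => /forallP m0.
  by apply/mnmP => i; rewrite mnm0E; apply/eqP/negPn/m0.
have := mcoeff_mderiv i Q (m - U_(i))%MM; rewrite Q0 mcoeff0 submK; last first.
  by rewrite lep1mP.
by move/esym/eqP; rewrite -mulr_natr mulf_eq0 (negPf (char0 _)) orbF => /eqP.
Qed.
End AffineSubstitution.
Arguments affine_subst : simpl never.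

(** * Classification of the semi-invariants *)

Section SemiInvariants.
Variables (K : fieldType) (sg : {rmorphism K -> K}) (N : nat).
Variables (f dp a de : K).
Variables (A : 'I_N.+1 -> 'I_N.+1 -> K) (e : 'I_N.+1 -> K).
Implicit Types P Q : {mpoly K[N.+1]}.
Local Notation tau := (affine_subst sg A e).

Hypothesis char0 : forall k, k.+1%:R != 0 :> K.
Hypotheses (dp_neq0 : dp != 0) (f_neq0 : f != 0).
Hypothesis A_triangular : forall i k : 'I_N.+1, (k < i)%N -> A i k = 0.
Hypothesis A_last : forall i : 'I_N.+1, (i < N)%N -> A i ord_max = 0.
Hypothesis A_diag : forall i : 'I_N.+1, (i < N)%N -> A i i = dp ^- (N - i).
Hypothesis A_subdiag : forall i k : 'I_N.+1, (k < N)%N -> k = i.+1 :> nat ->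
  A i k = - ((N - i)%:R * a + 'C(N - i, 2)%:R * de) * dp ^- (N - i).
Hypothesis e_pred : forall i : 'I_N.+1, i.+1 = N -> e i = - a / dp.
Hypothesis A_max : A ord_max ord_max = f^-1.
Hypothesis e_max : e ord_max = 0.

Hypothesis twist_dp : forall k j, sg k = dp ^+ j.+1 * k -> k = 0.
Hypothesis twist_f : forall k j, sg k = f ^+ j.+1 * k -> k = 0.
Hypothesis no_primitive : forall k s m, sg k = k ->
  s = dp * sg s - k * a - m%:R * de -> k = 0 /\ m = 0%N.

Lemma mderiv_tau_top (i : 'I_N.+1) Q : (forall j : 'I_N.+1, (j < i)%N -> Q^`M(j) = 0) ->
  (tau Q)^`M(i) = A i i *: tau Q^`M(i).
Proof.
move=> Q0; rewrite mderiv_affine_subst (bigD1 i) //= big1 ?addr0 // => j ji.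
have [lt|gt|/val_inj e0] := ltngtP j i; last by rewrite e0 eqxx in ji.
  by rewrite Q0 // rmorph0 scaler0.
by rewrite A_triangular // scale0r.
Qed.

Lemma mderiv_tau_max Q :
  (tau Q)^`M(ord_max) = f^-1 *: tau Q^`M(ord_max).
Proof.
rewrite mderiv_affine_subst (bigD1 ord_max) //= A_max big1 ?addr0 // => j jm.
by rewrite A_last ?scale0r // ltn_neqAle -ltnS ltn_ord andbT.
Qed.

Lemma semi_invariant_mderiv (i : 'I_N.+1) Q :
  (forall j : 'I_N.+1, (j < i)%N -> Q^`M(j) = 0) ->
  semi_invariant sg A e Q -> A i i != 0 -> semi_invariant sg A e Q^`M(i).
Proof.
move=> Q0 [c tQ] Ai; exists ((A i i)^-1 * c).
by rewrite -scalerA -mderivZ -tQ mderiv_tau_top // scalerA mulVf ?scale1r.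
Qed.

Lemma msize_mderiv_lt (i : 'I_N.+1) Q : Q^`M(i) != 0 -> (msize Q^`M(i) < msize Q)%N.
Proof.
move=> Q0; rewrite -mlead_deg //.
have := mlead_supp Q0; rewrite mcoeff_msupp mcoeff_mderiv.
set m := (_ + _)%MM => /eqP Qm.
have mQ : m \in msupp Q.
  by rewrite mcoeff_msupp; apply: contra_notN Qm => /eqP ->; rewrite mul0rn.
by have := msize_mdeg_lt mQ; rewrite /m mdegD mdeg1 addn1.
Qed.

(** Neither [G], the variable of index [N], nor any [y_j] with [j > N - m] occurs. In characteristic
    zero a variable is absent exactly when the derivative in it vanishes. *)
Definition free_below m Q := Q^`M(ord_max) = 0 /\
  forall j : 'I_N.+1, (j < m)%N -> Q^`M(j) = 0.

Lemma free_below_mderiv m (i : 'I_N.+1) Q : free_below m Q -> free_below m Q^`M(i).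
Proof.
move=> [Q1 Q2]; split=> [|j jm]; first by rewrite mderiv_comm Q1 mderiv0.
by rewrite mderiv_comm Q2 ?mderiv0.
Qed.

Lemma free_belowS (i : 'I_N.+1) Q : free_below i Q -> Q^`M(i) = 0 -> free_below i.+1 Q.
Proof.
move=> [Q1 Q2] Q0; split=> // j; rewrite ltnS leq_eqVlt => /orP[/eqP ji|/Q2//].
by rewrite (val_inj ji).
Qed.

Lemma free_below_const Q : free_below N Q -> exists q, Q = q%:MP.
Proof.
move=> [Q1 Q2]; exists Q@_0%MM; apply: mpoly_mderiv_eq0 => // i.
have [/Q2//|] := ltnP i N; rewrite leq_eqVlt ltnNge -ltnS ltn_ord orbF.
by move/eqP => /esym iN; rewrite (_ : i = ord_max) //; apply: val_inj.
Qed.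

Lemma A_diag_neq0 (i : 'I_N.+1) : (i < N)%N -> A i i != 0.
Proof. by move=> iN; rewrite A_diag // invr_neq0 // expf_neq0. Qed.

(** Differentiating in the highest variable that occurs preserves semi-invariance and lowers the
    size, so iteration reaches a polynomial of degree one in that variable. *)
Lemma exists_mderiv_top (i : 'I_N.+1) Q : (i < N)%N -> free_below i Q ->
    semi_invariant sg A e Q -> Q^`M(i) != 0 ->
  exists P, [/\ free_below i P, semi_invariant sg A e P, P^`M(i) != 0
    & P^`M(i)^`M(i) = 0].
Proof.
move=> iN; elim: (msize Q) {-2}Q (leqnn (msize Q)) => {Q} [|k IH] Q.
  rewrite leqn0 msize_poly_eq0 => /eqP -> _ _.
  by rewrite mderiv0 eqxx.
move=> sQ fQ siQ Q0; have [Q00|Q00] := eqVneq Q^`M(i)^`M(i) 0.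
  by exists Q.
apply: (IH Q^`M(i)) => //.
- by rewrite -ltnS (leq_trans (msize_mderiv_lt Q0)).
- exact: free_below_mderiv.
- by apply: semi_invariant_mderiv (A_diag_neq0 iN) => //; case: fQ.
Qed.

Lemma free_below_linear (i : 'I_N.+1) Q q : i.+1 = N -> free_below i Q ->
  Q^`M(i) = q%:MP -> exists r, Q = q *: 'X_i + r%:MP.
Proof.
move=> iN [Q1 Q2] Qi.
have [|r rE] := @free_below_const (Q - q *: 'X_i); last first.
  by exists r; rewrite -rE addrC subrK.
split=> [|j]; rewrite mderivB mderivZ mderivXU.
  rewrite Q1 (_ : i == ord_max = false) ?mpolyC0 ?scaler0 ?subr0 //.
  by rewrite -val_eqE /= ltn_eqF // -[X in (_ < X)%N]iN.
rewrite -[X in (_ < X)%N]iN ltnS leq_eqVlt => /orP[/eqP/val_inj->|ji].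
  by rewrite Qi eqxx mpolyC1 -mul_mpolyC mulr1 subrr.
rewrite Q2 // (_ : i == j = false) ?mpolyC0 ?scaler0 ?subr0 //.
by rewrite -val_eqE /= gtn_eqF.
Qed.

Lemma mcoeff0_affine_form i : (affine_form A e i)@_0%MM = e i.
Proof.
rewrite mcoeff_affine_form eqxx mulr1 big1 ?add0r // => k _.
by rewrite mnm1_eq0 mulr0.
Qed.

Lemma mcoeff0_tau_linear (i : 'I_N.+1) q r :
  (tau (q *: 'X_i + r%:MP))@_0%MM = sg q * e i + sg r.
Proof.
rewrite rmorphD /= affine_substZ affine_substX affine_substC.
by rewrite mcoeffD mcoeffZ mcoeff0_affine_form mcoeffC eqxx mulr1.
Qed.

Lemma mcoeff0_linear (i : 'I_N.+1) q r :
  (q *: 'X_i + r%:MP : {mpoly K[N.+1]})@_0%MM = r.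
Proof.
by rewrite mcoeffD mcoeffZ mcoeffX mnm1_eq0 mulr0 add0r mcoeffC eqxx mulr1.
Qed.

(** The derivative of the equation in the top variable [y_(N-j)] no longer contains [h]: it makes
    the derivative of [S] semi-invariant, hence a constant [q], with [sg q = dp ^+ (N - j - 1) * q].
    For [N - j > 1], [twist_dp] forces [q = 0]; so only [y_1] can occur, with a coefficient fixed by
    [sg]. *)
Lemma twisted_primitive_linear m S h : (m < N)%N -> free_below m S ->
  (forall P, free_below m P -> semi_invariant sg A e P -> exists q, P = q%:MP) ->
  S = dp *: tau S - h%:MP ->
  exists q s, sg q = q /\ s = dp * sg s - q * a - h.
Proof.
move=> mN fS const Seq.
have SM (j : 'I_N.+1) : (j < N)%N -> (m <= j)%N -> free_below j S ->
    exists q, S^`M(j) = q%:MP /\ q = dp * (dp ^- (N - j) * sg q).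
  move=> jN mj fj.
  have eq : S^`M(j) = (dp * dp ^- (N - j)) *: tau S^`M(j).
    rewrite {1}Seq mderivB mderivC subr0 mderivZ mderiv_tau_top; last by case: fj.
    by rewrite A_diag // scalerA.
  have [q qE] : exists q, S^`M(j) = q%:MP.
    apply: const; first exact: free_below_mderiv.
    exists (dp * dp ^- (N - j))^-1; rewrite [in RHS]eq scalerA mulVf ?scale1r //.
    by rewrite mulf_neq0 ?invr_neq0 ?expf_neq0.
  exists q; split=> //; move: eq; rewrite qE affine_substC -mul_mpolyC -mpolyCM.
  by move/(congr1 (mcoeff 0%MM)); rewrite !mcoeffC eqxx !mulr1 -mulrA.
have fSj j : (m <= j)%N -> (j < N)%N -> free_below j S.
  elim: j => [|j IH]; first by rewrite leqn0 => /eqP m0; rewrite m0 in fS.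
  rewrite leq_eqVlt => /orP[/eqP <- //|]; rewrite ltnS => mj jN.
  have jN1 : (j < N.+1)%N by rewrite ltnW // ltnW.
  pose j' := Ordinal jN1.
  have fj' : free_below j' S by apply: IH => //; exact: ltnW.
  have [||q [Sq qE]] := SM j' _ _ fj' => //; first exact: ltnW.
  apply: (@free_belowS j') => //; rewrite Sq.
  (* The exponent is [N - j - 1], and [twist_dp] is stated for the exponent [j.+1]. *)
  rewrite (@twist_dp q (N - j).-2) ?mpolyC0 //.
  have NjE : (N - j = (N - j).-2.+2)%N.
    by move: jN; rewrite -subn_gt0 subnS; case: (N - j)%N => [|[]].
  by rewrite {2}qE [(N - j')%N]NjE !mulrA -exprSr divff ?mul1r ?expf_neq0.
have N0 : (0 < N)%N by case: (N) mN.
have ltl : (N.-1 < N.+1)%N by rewrite prednK // ltnW.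
pose l := Ordinal ltl; have lN : l.+1 = N by rewrite /= prednK.
have lN' : (l < N)%N by rewrite -[X in (_ < X)%N]lN.
have ml : (m <= l)%N by rewrite -ltnS lN.
have fl := fSj l ml lN'.
have [q [Sq qE]] := SM l lN' ml fl.
have {}qE : sg q = q.
  rewrite {2}qE -[X in (X - l)%N]lN subSnn expr1 mulrA divff ?mul1r //.
exists q; have [s sE] := free_below_linear lN fl Sq; exists s; split=> //.
have := congr1 (mcoeff 0%MM) Seq; rewrite {1}sE mcoeff0_linear => {1}->.
rewrite mcoeffB mcoeffZ sE mcoeff0_tau_linear mcoeffC eqxx mulr1 qE.
by rewrite e_pred //; field.
Qed.

(** Induction on the number of variables [y_1, ..., y_k] allowed. If a further variable [y_(k+1)]
    occurred, derivatives and scaling would give a semi-invariant [R], equal to [y_(k+1)] plus a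
    polynomial in the others, with multiplier [dp ^- k.+1]; its lower terms would solve the additive
    equation excluded by [no_primitive]. *)
Lemma semi_invariant_const k Q : (k <= N)%N -> free_below (N - k) Q ->
  semi_invariant sg A e Q -> exists q, Q = q%:MP.
Proof.
elim: k Q => [|k IHk] Q kN fQ siQ.
  by apply: free_below_const; rewrite subn0 in fQ.
have {}IHk P : free_below (N - k) P -> semi_invariant sg A e P ->
  exists q, P = q%:MP by apply: IHk; exact: ltnW.
have ltN : (N - k.+1 < N.+1)%N by rewrite ltnS leq_subr.
pose i0 : 'I_N.+1 := Ordinal ltN.
have i0N : (i0 < N)%N by rewrite /= ltn_subrL /= (leq_trans _ kN).
have i0S : (i0.+1 = N - k)%N by rewrite /= subnSK.
have [Qi0|Qi0] := eqVneq Q^`M(i0) 0.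
  by apply: IHk siQ; rewrite -i0S; exact: free_belowS.
suff: False by [].
have [{Qi0 siQ}P [fP [c tP] Pi0 Pi00]] := exists_mderiv_top i0N fQ siQ Qi0.
have [q Pq] : exists q, P^`M(i0) = q%:MP.
  apply: IHk; first by rewrite -i0S; apply: free_belowS; first exact: free_below_mderiv.
  apply: semi_invariant_mderiv (A_diag_neq0 i0N); first by case: fP.
  by exists c.
have q0 : q != 0 by apply: contraNneq Pi0 => q0; rewrite Pq q0 mpolyC0.
pose R := q^-1 *: P.
have fR : free_below i0 R.
  by case: fP => F1 F2; split=> [|j /F2 F]; rewrite mderivZ ?F1 ?F scaler0.
have Ri0 : R^`M(i0) = 1.
  by rewrite mderivZ Pq -mul_mpolyC -mpolyCM mulVf // mpolyC1.
have [b tR] : exists b, tau R = b *: R.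
  exists (sg q^-1 * c * q); rewrite affine_substZ tP !scalerA.
  by rewrite mulfK.
have bE : b = A i0 i0.
  have := congr1 (mderiv i0) tR; rewrite mderivZ Ri0 mderiv_tau_top ?Ri0.
    rewrite rmorph1 => /eqP; rewrite -subr_eq0 -scalerBl scaler_eq0 oner_eq0.
    by rewrite orbF subr_eq0 => /eqP.
  by case: fR.
have tR0 := congr1 (mcoeff 0%MM) tR.
have DE : (N - i0 = k.+1)%N by rewrite /= subKn.
clearbody R i0; clear Q Pi0 Pi00 Pq fP fQ tP P q q0 ltN c.
(* If [y_1] is the only variable, [R = y_1 + r] and the constant terms give [r = dp * sg r - a]. *)
case: k => [|k] in kN IHk i0S DE *.
  rewrite subn0 in i0S.
  have [r rE] := free_below_linear i0S fR (etrans Ri0 (esym (@mpolyC1 _ _))).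
  move: tR0; rewrite mcoeffZ rE mcoeff0_tau_linear mcoeff0_linear rmorph1 mul1r.
  rewrite bE A_diag // DE expr1 e_pred // => e0.
  have [] := @no_primitive 1 r 0; rewrite ?rmorph1 ?mul0r ?mul1r ?subr0 //.
    by apply: (mulfI (invr_neq0 dp_neq0)); rewrite -e0; field.
  by move/eqP; rewrite oner_eq0.
have i1N : (i0.+1 < N.+1)%N by rewrite i0S ltnS leq_subr.
pose i1 := Ordinal i1N.
have i1N' : (i1 < N)%N by rewrite [X in (X < _)%N]i0S ltn_subrL /= (leq_trans _ kN).
(* Otherwise [R] is differentiated in the second highest variable. The image of the top variable
   contributes the subdiagonal entry of [A], which is the inhomogeneous term. *)
have [|||q [s [qE]]] := @twisted_primitive_linear i1 R^`M(i1)
  (k.+2%:R * a + 'C(k.+2, 2)%:R * de) i1N'.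
- split=> [|j]; first by rewrite mderiv_comm fR.1 mderiv0.
  rewrite ltnS leq_eqVlt mderiv_comm => /orP[/eqP/val_inj->|/fR.2->].
    by rewrite Ri0 -mpolyC1 mderivC.
  by rewrite mderiv0.
- by rewrite [X in free_below X]i0S.
- have i01 : i0 != i1 by rewrite -val_eqE /= ltn_eqF.
  have := congr1 (mderiv i1) tR; rewrite mderivZ mderiv_affine_subst.
  rewrite (bigD1 i0) //= (bigD1 i1) /= ?(eq_sym i1) // Ri0 rmorph1.
  rewrite big1 ?addr0 => [|j /andP[ji0 ji1]]; last first.
    have [ji|ij|/val_inj e0] := ltngtP j i0; last by rewrite e0 eqxx in ji0.
      by rewrite fR.2 // rmorph0 scaler0.
    rewrite A_triangular ?scale0r // ltn_neqAle eq_sym ij andbT.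
    by rewrite val_eqE.
  have N1 : (N - i1 = k.+1)%N by rewrite subnS DE.
  rewrite bE A_subdiag // !A_diag // N1 DE => eq1.
  apply: (scalerI (invr_neq0 (expf_neq0 k.+2 dp_neq0))).
  rewrite -eq1 scalerBr scalerA addrC; congr (_ *: _ + _).
    by rewrite [in RHS]exprS invfM mulrAC mulVf ?mul1r.
  by rewrite -!mul_mpolyC mulr1 -mpolyCM -mpolyCN mulNr [in RHS]mulrC.
(* The contradiction comes from [m = 'C(k.+2, 2)], which is positive whatever the constant
   [q + k.+2%:R] is. *)
move=> sE; have [] := @no_primitive (q + k.+2%:R) s 'C(k.+2, 2).
- by rewrite rmorphD rmorph_nat qE.
- by rewrite {1}sE; ring.
by rewrite binS bin1 addnS.
Qed.

Lemma mderiv_Xn (i : 'I_N.+1) m :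
  ('X_i ^+ m.+1 : {mpoly K[N.+1]})^`M(i) = m.+1%:R *: 'X_i ^+ m.
Proof.
elim: m => [|m IH].
  by rewrite expr1 expr0 mderivXU eqxx mpolyC1 scale1r.
rewrite exprS mderivM IH mderivXU eqxx mpolyC1 mul1r -scalerAr.
by rewrite -exprS -[in RHS]natr1 scalerDl scale1r addrC.
Qed.

Lemma tau_Xmax : tau 'X_ord_max = f^-1 *: 'X_ord_max.
Proof.
rewrite affine_substX /affine_form e_max mpolyC0 addr0 (bigD1 ord_max) //=.
rewrite A_max big1 ?addr0 // => j jm; rewrite A_triangular ?scale0r //=.
by rewrite ltn_neqAle -ltnS ltn_ord andbT.
Qed.

(** Write [X] for the last variable. By induction the derivative in [X] is [q X^m], so [Q] differs
    from [q/(m+1) X^(m+1)] by a semi-invariant free of [X], that is a constant [r], with the same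
    multiplier as [Q]. If [r] is nonzero, [sg (q/r) = f^(m+1) (q/r)], against [twist_f]. *)
Lemma semi_invariant_monomial Q : Q != 0 -> semi_invariant sg A e Q ->
  exists q m, Q = q *: 'X_ord_max ^+ m.
Proof.
elim: (msize Q) {-2}Q (leqnn (msize Q)) => {Q} [|k IH] Q.
  by rewrite leqn0 msize_poly_eq0 => /eqP->; rewrite eqxx.
move=> sQ Q0 [c tQ]; have [Q1|Q1] := eqVneq Q^`M(ord_max) 0.
  have [||q ->] := @semi_invariant_const N Q (leqnn N); last 1 first.
  - by exists q, 0%N; rewrite expr0 -mul_mpolyC mulr1.
  - by rewrite subnn; split.
  - by exists c.
have tP : tau Q^`M(ord_max) = (f * c) *: Q^`M(ord_max).
  by rewrite -scalerA -mderivZ -tQ mderiv_tau_max scalerA divff // scale1r.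
have [|//||q [m PE]] := IH Q^`M(ord_max).
- by rewrite -ltnS (leq_trans (msize_mderiv_lt Q1)).
- by exists (f * c).
have X0 j : ('X_ord_max ^+ j : {mpoly K[N.+1]}) != 0.
  by rewrite expf_neq0 // -mleadc_eq0 mleadXm mcoeffX eqxx oner_neq0.
have tXn j : tau ('X_ord_max ^+ j) = f ^- j *: 'X_ord_max ^+ j.
  by rewrite rmorphXn /= tau_Xmax exprZn exprVn.
have qE : sg q = f ^+ m.+1 * (c * q).
  move: tP; rewrite PE affine_substZ tXn !scalerA => /eqP.
  rewrite -subr_eq0 -scalerBl scaler_eq0 (negPf (X0 _)) orbF subr_eq0 => /eqP e1.
  by rewrite exprSr -mulrA [f * _]mulrA -e1 mulrCA divff ?mulr1 ?expf_neq0.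
have q0 : q != 0 by apply: contraNneq Q1 => q0; rewrite PE q0 scale0r.
pose R := Q - (q / m.+1%:R) *: 'X_ord_max ^+ m.+1.
have tR : tau R = c *: R.
  rewrite rmorphB /= tQ affine_substZ tXn scalerBr !scalerA; congr (_ - _ *: _).
  rewrite rmorphM fmorphV rmorph_nat qE.
  have := expf_neq0 m.+1 f_neq0; have := char0 m.
  by move: (f ^+ m.+1) m.+1%:R => F M M0 F0; field; rewrite F0 M0.
have [||r RE] := @semi_invariant_const N R (leqnn N).
- rewrite subnn; split=> //; rewrite mderivB mderivZ mderiv_Xn PE scalerA.
  by rewrite divfK ?subrr.
- by exists c.
have [r0|r0] := eqVneq r 0.
  exists (q / m.+1%:R), m.+1; apply/eqP.
  by rewrite -subr_eq0 -/R RE r0 mpolyC0.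
move: tR; rewrite RE affine_substC -mul_mpolyC -mpolyCM.
move/(congr1 (mcoeff 0%MM)); rewrite !mcoeffC eqxx !mulr1 => rE.
have c0 : c != 0.
  apply: contraNneq r0 => c0; move: rE; rewrite c0 mul0r => /eqP.
  by rewrite fmorph_eq0.
have /eqP : q / r = 0.
  apply: (@twist_f _ m); rewrite rmorphM fmorphV qE rE.
  by move: (f ^+ m.+1) => F; field; rewrite c0 r0.
by rewrite mulf_eq0 invr_eq0 (negPf q0) (negPf r0).
Qed.
End SemiInvariants.

(** * The quadratic map [v^2 - 3 v] and rational functions *)

Section BackwardOrbit.
Variable R : realType.

(** Inverse branch of [v^2 - 3 v] on the right of the critical point [3/2]; the critical value is
    [-9/4]. *)
Definition inv_branch (w : R) : R := (3 + Num.sqrt (9 + 4 * w)) / 2.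

Lemma inv_branchK w : - 9 / 4 < w -> inv_branch w ^+ 2 - 3 * inv_branch w = w.
Proof.
move=> w9; have := @sqr_sqrtr R (9 + 4 * w).
rewrite /inv_branch; move: (Num.sqrt _) => r rE.
have {}rE : r ^+ 2 = 9 + 4 * w by apply: rE; lra.
transitivity ((r ^+ 2 - 9) / 4); first by field.
by rewrite rE; field.
Qed.

Lemma inv_branch_gt w : - 9 / 4 < w -> 3 / 2 < inv_branch w.
Proof.
move=> w9; have : 0 < Num.sqrt (9 + 4 * w) by rewrite sqrtr_gt0; lra.
by rewrite /inv_branch; lra.
Qed.

(** With [r] the square root and [x] the image of [w], [(r + 5) (x - 4) = 2 (w - 4)], where
    [r + 5 > 2]: the branch contracts towards the fixed point 4. *)
Lemma inv_branch_contract w : - 9 / 4 < w -> w != 4 ->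
  inv_branch w != 4 /\ `|inv_branch w - 4| < `|w - 4|.
Proof.
move=> w9 w4; have r0 : 0 < Num.sqrt (9 + 4 * w) by rewrite sqrtr_gt0; lra.
have := inv_branchK w9; rewrite /inv_branch; move: (Num.sqrt _) r0 => r r0 e.
have e' : (r + 5) * ((3 + r) / 2 - 4) = 2 * (w - 4) by rewrite -e; field.
set x := (3 + r) / 2 - 4 in e' *.
have x0 : x != 0.
  apply: contraNneq w4 => x0; move/eqP: e'; rewrite x0 mulr0 eq_sym mulf_eq0.
  by rewrite subr_eq0 => /orP[/eqP|//]; lra.
split; first by rewrite -subr_eq0.
have xp : 0 < `|x| by rewrite normr_gt0.
have := congr1 Num.norm e'; rewrite !normrM (@gtr0_norm _ (r + 5)); last by lra.
rewrite (@gtr0_norm _ 2) ?ltr0n // => e''.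
by nra.
Qed.
End BackwardOrbit.

Lemma frac_coprime (F : fieldType) (x : {fraction {poly F}}) :
  exists n d, [/\ d != 0, coprimep n d & x = n%:F / d%:F].
Proof.
rewrite (frac_numden x); have := denom_ratioP (repr x).
move: (\n_(repr x)) (\d_(repr x)) => a b b0.
pose g := gcdp a b; have g0 : g != 0 by rewrite gcdp_eq0 negb_and b0 orbT.
have aE : a = a %/ g * g by rewrite divpK // dvdp_gcdl.
have bE : b = b %/ g * g by rewrite divpK // dvdp_gcdr.
have b'0 : b %/ g != 0 by apply: contraNneq b0 => b'0; rewrite bE b'0 mul0r.
exists (a %/ g), (b %/ g); split=> //; first by rewrite coprimep_div_gcd ?b0 ?orbT.
rewrite {1}aE {1}bE !rmorphM /= -mulf_div divff ?mulr1 //.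
by rewrite tofrac_eq0.
Qed.

Section RationalFunctions.
Variable R : realType.
Local Notation C := R[i].
Local Notation K := {fraction {poly C}}.

Definition quad : {poly C} := 'X ^+ 2 - 3 *: 'X.

Lemma size_quad : size quad = 3%N.
Proof.
rewrite size_polyDl size_polyXn // size_polyN.
by rewrite (leq_ltn_trans (size_scale_leq _ _)) // size_polyX.
Qed.

Lemma lead_coef_quad : lead_coef quad = 1.
Proof.
rewrite lead_coefDl ?lead_coefXn // size_polyN size_polyXn.
by rewrite (leq_ltn_trans (size_scale_leq _ _)) // size_polyX.
Qed.

Lemma horner_quad q : quad.[q] = q ^+ 2 - 3 * q.
Proof. by rewrite !hornerE. Qed.

Lemma deriv_quad : quad^`() = 2 *: 'X - 3%:P.
Proof.
rewrite derivB derivXn derivZ derivX expr1 alg_polyC -scaler_nat.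
by [].
Qed.

Lemma comp_quad_eq0 (q : {poly C}) : (q \Po quad == 0) = (q == 0).
Proof. by rewrite comp_poly_eq0 // size_quad. Qed.

Definition comp_quad : {poly C} -> K := @FracField.tofrac _ \o comp_poly quad.
HB.instance Definition _ := GRing.RMorphism.on comp_quad.

Lemma comp_quad_inj : injective comp_quad.
Proof.
by apply: raddf_inj => q /eqP; rewrite /= tofrac_eq0 comp_quad_eq0 => /eqP.
Qed.

Definition quad_subst : K -> K := frac_ext comp_quad_inj.
HB.instance Definition _ :=
  GRing.isZmodMorphism.Build _ _ quad_subst (frac_ext_zmod_morphism _).
HB.instance Definition _ :=
  GRing.isMonoidMorphism.Build _ _ quad_subst (frac_ext_monoid_morphism _).

(* The derivation d/dt, where [t = 4 / v] and [v] is the variable ['X]. *)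
Definition der_t : K -> K :=
  fun x => - ('X%:F ^+ 2 / 4) * frac_der (@deriv C) x.

Lemma quad_subst_div n d : d != 0 ->
  quad_subst (n%:F / d%:F) = (n \Po quad)%:F / (d \Po quad)%:F.
Proof. exact: frac_ext_div. Qed.

Lemma quad_subst_tofrac q : quad_subst q%:F = (q \Po quad)%:F.
Proof. exact: frac_ext_tofrac. Qed.

Lemma comp_quad_neq0 (q : {poly C}) : q != 0 -> q \Po quad != 0.
Proof. by rewrite comp_quad_eq0. Qed.

(** For [x = n / d] in lowest terms, [n(q) d = n d(q)], and [n(q)] is coprime to [d(q)]. Hence
    [n(q)] divides [n] although its degree is twice that of [n]; the same holds for [d], and both
    are constants. *)
Lemma quad_subst_fixed x : quad_subst x = x -> exists c : C, x = c%:P%:F.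
Proof.
have [n [d [d0 cop ->]]] := frac_coprime x.
have [-> _|n0] := eqVneq n 0; first by exists 0; rewrite mul0r.
rewrite quad_subst_div // => /eqP; rewrite eqr_div ?tofrac_eq0 ?comp_quad_eq0 //.
rewrite -!rmorphM tofrac_eq => /eqP e.
have cop' := coprimep_comp_poly quad cop.
have size1 (p : {poly C}) : p != 0 -> p \Po quad %| p -> exists2 c, c != 0 & p = c%:P.
  move=> p0 /(dvdp_leq p0) le; have := size_comp_poly p quad.
  rewrite size_quad => e2; apply/size_poly1P.
  have := size_poly_gt0 p; rewrite p0.
  have := size_poly_gt0 (p \Po quad); rewrite comp_quad_eq0 p0.
  by move: le e2; case: (size p) (size (p \Po quad)) => [|[|k]] [|l] //=; lia.
have [|c _ nc] := size1 n n0.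
  by rewrite -(Gauss_dvdpl _ cop') -e dvdp_mulr.
have [|b b0 db] := size1 d d0.
  rewrite coprimep_sym in cop'.
  by rewrite -(Gauss_dvdpr _ cop') e dvdp_mull.
exists (c / b); rewrite nc db; apply: (canLR (mulfK _)).
  by rewrite tofrac_eq0 polyC_eq0.
by rewrite -rmorphM -polyCM divfK.
Qed.

(** As [quad] is monic, the substitution keeps leading coefficients, and comparing them gives
    [2 ^ j.+1 = 1]. *)
Lemma quad_subst_twist_deriv_quad x j :
  quad_subst x = (quad^`())%:F ^+ j.+1 * x -> x = 0.
Proof.
have [n [d [d0 cop ->]]] := frac_coprime x.
have [->|n0] := eqVneq n 0; first by rewrite mul0r.
rewrite quad_subst_div // -rmorphXn mulrA -rmorphM => /eqP.
rewrite eqr_div ?tofrac_eq0 ?comp_quad_eq0 // -!rmorphM tofrac_eq => /eqP.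
move/(congr1 lead_coef); rewrite !lead_coefM lead_coef_exp.
rewrite !lead_coef_comp ?size_quad // lead_coef_quad !expr1n !mulr1.
have -> : lead_coef quad^`() = 2.
  rewrite deriv_quad lead_coefDl ?lead_coefZ ?lead_coefX ?mulr1 //.
  by rewrite size_polyN size_scale ?pnatr_eq0 // size_polyX size_polyC; case: eqP.
have nd : lead_coef n * lead_coef d != 0 by rewrite mulf_neq0 ?lead_coef_eq0.
rewrite -mulrA -{1}[lead_coef n * _]mul1r => /(mulIf nd)/eqP.
rewrite eq_sym -(natrX _ 2) pnatr_eq1 => /eqP e2.
by have := ltn_expl j.+1 (ltnSn 1); rewrite e2.
Qed.

(** * Poles of the solutions of the additive equation *)

Section Poles.
Variables (d n : {poly C}) (al be : C).
Hypotheses (d0 : d != 0) (cop : coprimep n d).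
Let u : {poly C} := 'X - 1%:P.
Let w : {poly C} := 2 *: 'X - 3%:P.
Hypothesis eq_nd : n * (d \Po quad) * (u * w) =
  w * (n \Po quad) * d * (u * w) + (al *: w + be *: u) * d * (d \Po quad).

Lemma eq_nd_horner q : n.[q] * d.[quad.[q]] * ((q - 1) * (2 * q - 3)) =
  (2 * q - 3) * n.[quad.[q]] * d.[q] * ((q - 1) * (2 * q - 3)) +
  (al * (2 * q - 3) + be * (q - 1)) * d.[q] * d.[quad.[q]].
Proof.
have := congr1 (horner^~ q) eq_nd.
by rewrite !(hornerM, hornerD, hornerN, hornerZ, hornerX, hornerC, horner_comp).
Qed.

(** Away from 1 and [3/2] the inhomogeneous term is regular and the factor [2 q - 3] does not
    vanish, so [n / d] has a pole at [q] exactly when it has one at [quad q]. *)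
Lemma pole_quad q : q != 1 -> 2 * q != 3 -> root d q = root d quad.[q].
Proof.
move=> q1 q3; have eq := eq_nd_horner q.
have z1 : (q - 1) * (2 * q - 3) != 0 by rewrite mulf_neq0 ?subr_eq0.
have z2 : 2 * q - 3 != 0 by rewrite subr_eq0.
have cop' : coprimep d n by rewrite coprimep_sym.
apply/idP/idP => dq; move: eq (dq) => /[swap]; rewrite /root => /eqP->.
  rewrite !(mulr0, mul0r, addr0) => /eqP; rewrite mulf_eq0.
  rewrite (negPf z1) orbF mulf_eq0.
  by rewrite (negPf (coprimep_root cop' dq)).
rewrite !(mulr0, mul0r, addr0) => /esym/eqP.
have nq := coprimep_root cop' dq.
rewrite mulf_eq0 (negPf z1) orbF mulf_eq0 mulf_eq0 (negPf z2).
by rewrite (negPf nq).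
Qed.

(** A pole could be pulled back forever along [inv_branch]. The points obtained stay above [3/2],
    hence avoid both exceptional points, and their distances to 4 strictly decrease, so [d] would
    have too many roots. *)
Lemma real_pole_free (r : R) : - 9 / 4 < r -> r != 4 -> ~~ root d r%:C%C.
Proof.
move=> r9 r4; apply/negP => dr.
have orbit k : let x := iter k (@inv_branch R) r in
    [/\ - 9 / 4 < x, x != 4 & root d x%:C%C].
  elim: k => [|k [x9 x4 dx]] //=; set x := iter k _ _ in x9 x4 dx *.
  have gx := inv_branch_gt x9; have [g4 _] := inv_branch_contract x9 x4.
  split=> //; first lra.
  rewrite pole_quad.
  - rewrite horner_quad -(rmorphXn (real_complex R)).
    rewrite -(rmorph_nat (real_complex R) 3) -(rmorphM (real_complex R)).
    by rewrite -(rmorphB (real_complex R)) /= inv_branchK.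
  - rewrite -(rmorph1 (real_complex R)) (inj_eq (fmorph_inj _)).
    by apply: contraTneq gx => ->; rewrite -leNgt; lra.
  - rewrite -(rmorph_nat (real_complex R) 3) -(rmorph_nat (real_complex R) 2).
    rewrite -(rmorphM (real_complex R)) (inj_eq (fmorph_inj _)).
    by apply: contraTneq gx => e; rewrite -leNgt; lra.
have decr k l : (k < l)%N ->
    `|iter l (@inv_branch R) r - 4| < `|iter k (@inv_branch R) r - 4|.
  elim: l => // l IH; rewrite ltnS leq_eqVlt => /orP[/eqP->|/IH].
    by have [x9 x4 _] := orbit l; have [] := inv_branch_contract x9 x4.
  apply: le_lt_trans; apply: ltW.
  by have [x9 x4 _] := orbit l; have [] := inv_branch_contract x9 x4.
pose s := [seq (iter k (@inv_branch R) r)%:C%C | k <- iota 0 (size d)].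
suff : (size s < size d)%N by rewrite size_map size_iota ltnn.
apply: max_poly_roots => //; first by apply/allP => _ /mapP[k _ ->]; have [] := orbit k.
rewrite map_inj_uniq ?iota_uniq // => k l /(fmorph_inj (real_complex R)) e.
by have [/decr|/decr|//] := ltngtP k l; rewrite e ltxx.
Qed.

Lemma no_residues : al = 0 /\ be = 0.
Proof.
have rr (r : R) : - 9 / 4 < r -> r != 4 -> d.[r%:C%C] != 0.
  by move=> r9 r4; have := real_pole_free r9 r4.
(* At [v = 1] the equation says that [al] times [d(1) d(-2)] is zero, and [quad 1 = -2] is still
   above [-9/4]. *)
have al0 : al = 0.
  have := eq_nd_horner 1; rewrite subrr !(mul0r, mulr0) addr0 add0r horner_quad.
  have -> : 1 ^+ 2 - 3 * 1 = (- 2)%:C%C :> C.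
    by rewrite rmorphN rmorph_nat; ring.
  have d1 : d.[1] != 0 by have := @rr 1; rewrite rmorph1; apply; [lra|apply/eqP; lra].
  have d2 : d.[(- 2)%:C%C] != 0 by apply: rr; [lra|apply/eqP; lra].
  move/esym/eqP; rewrite !mulf_eq0 (negPf d1) (negPf d2) !orbF.
  by rewrite (_ : 2 * 1 - 3 = -1) ?oppr_eq0 ?oner_eq0 ?orbF => [/eqP|]; last by ring.
split=> //.
pose h : R := 3 / 2; have hE : 2 * h%:C%C - 3 = 0 :> C.
  rewrite /h rmorphM fmorphV !rmorph_nat mulrC divfK ?subrr //.
  by rewrite pnatr_eq0.
have := eq_nd_horner h%:C%C; rewrite hE al0 !(mul0r, mulr0, add0r).
have -> : quad.[h%:C%C] = (- 9 / 4)%:C%C.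
  rewrite horner_quad -(rmorphXn (real_complex R)).
  rewrite -(rmorph_nat (real_complex R) 3) -(rmorphM (real_complex R)).
  by rewrite -(rmorphB (real_complex R)) /h; congr (_ %:C)%C; field.
have d1 : d.[h%:C%C] != 0 by apply: rr; rewrite /h; [lra|apply/eqP; lra].
have d2 : d.[(- 9 / 4)%:C%C] != 0.
  (* The critical value [-9/4] escapes [real_pole_free], but its forward image [189/16] does not. *)
  change (~~ root d (- 9 / 4)%:C%C); rewrite pole_quad.
  - rewrite horner_quad -(rmorphXn (real_complex R)).
    rewrite -(rmorph_nat (real_complex R) 3) -(rmorphM (real_complex R)).
    by rewrite -(rmorphB (real_complex R)); apply: rr; [lra|apply/eqP; lra].
  - rewrite -(rmorph1 (real_complex R)) (inj_eq (fmorph_inj _)).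
    by apply/eqP; lra.
  - rewrite -(rmorph_nat (real_complex R) 3) -(rmorph_nat (real_complex R) 2).
    rewrite -(rmorphM (real_complex R)) (inj_eq (fmorph_inj _)).
    by apply/eqP; lra.
move/esym/eqP; rewrite !mulf_eq0 (negPf d1) (negPf d2) !orbF.
case/orP => /eqP // /eqP; rewrite -(rmorph1 (real_complex R)) -rmorphB fmorph_eq0.
rewrite /h => /eqP h1; have : (0 : R) < 3 / 2 - 1 by lra.
by rewrite h1 ltxx.
Qed.
End Poles.

End RationalFunctions.

(* Since [s dt = - 4 s / v ^ 2 dv], the equation for [s] becomes one for
   [- 4 s / v ^ 2]; subtracting coboundaries leaves only two poles. *)
Lemma partial_fractions_gauge (F : fieldType) (v s s' k m : F) :
  let q := v ^+ 2 - 3 * v in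
  let U := - 4 * s / v ^+ 2 + k * (- (v - 4)^-1 - (v + 2)^-1 + v^-1)
    + m * (2 / v) in
  let U' := - 4 * s' / q ^+ 2 + k * (- (q - 4)^-1 - (q + 2)^-1 + q^-1)
    + m * (2 / q) in
  (4 : F) != 0 -> v != 0 -> v - 3 != 0 -> v + 1 != 0 -> v - 2 != 0 ->
  v + 2 != 0 -> v - 4 != 0 -> v - 1 != 0 -> 2 * v - 3 != 0 ->
  s = (2 * v - 3) * (v / q) ^+ 2 * s'
    - k * (- (v ^+ 2 / 4) * ((v + 1)^-1 + (v - 2)^-1 - (v + 2)^-1 - (v - 3)^-1))
    - m * (- (v ^+ 2 / 4) * (2 / (2 * v - 3) + 2 / v - 2 * ((2 * v - 3) / q))) ->
  U = (2 * v - 3) * U' + (k / (v - 1) + - 2 * m / (2 * v - 3)).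
Proof.
move=> /= n4 v0 v3 v1 v2 v2' v4 v1' vd ->.
have -> : v ^+ 2 - 3 * v = v * (v - 3) by ring.
have -> : v * (v - 3) - 4 = (v - 4) * (v + 1) by ring.
have -> : v * (v - 3) + 2 = (v - 1) * (v - 2) by ring.
by field; rewrite n4 v0 v3 v1 v2 v2' v4 v1' vd.
Qed.

(** * The functional equation in the coordinate [v] *)

Section Decimation.
Variables (F : fieldType) (v : F) (sg : {rmorphism F -> F}) (D : F -> F).
Local Notation q := (v ^+ 2 - 3 * v).

(** This is [f], and the next definition is [d'], both written at [t = 4/v]. *)
Definition decim_factor : F := (v + 1) * (v - 2) / ((v + 2) * (v - 3)).
Definition decim_deriv : F := (2 * v - 3) * (v / q) ^+ 2.
Definition dlog x := D x / x.

Hypothesis char0 : forall k, k.+1%:R != 0 :> F.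
Hypothesis v_add_nat : forall k, v + k%:R != 0.
Hypothesis v_sub_nat : forall k, v - k%:R != 0.
Hypothesis v_half : 2 * v - 3 != 0.
Hypothesis sgv : sg v = q.
Hypothesis DD : forall x y, D (x + y) = D x + D y.
Hypothesis DM : forall x y, D (x * y) = D x * y + x * D y.
Hypothesis Dv : D v = - (v ^+ 2 / 4).
Hypothesis Dsg : forall x, D (sg x) = decim_deriv * sg (D x).
Hypothesis no_residue : forall k U m, sg k = k ->
  U = (2 * v - 3) * sg U + (k / (v - 1) + - 2 * m%:R / (2 * v - 3)) ->
  k = 0 /\ m = 0%N.
Hypothesis no_twist : forall x j, sg x = (2 * v - 3) ^+ j.+1 * x -> x = 0.

Let v0 : v != 0. Proof. by have := v_add_nat 0; rewrite addr0. Qed.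
Let v1 : v + 1 != 0. Proof. exact: (v_add_nat 1). Qed.
Let v1' : v - 1 != 0. Proof. exact: (v_sub_nat 1). Qed.
Let v2 : v + 2 != 0. Proof. exact: v_add_nat. Qed.
Let v2' : v - 2 != 0. Proof. exact: v_sub_nat. Qed.
Let v3' : v - 3 != 0. Proof. exact: v_sub_nat. Qed.
Let v4' : v - 4 != 0. Proof. exact: v_sub_nat. Qed.
Let q0 : q != 0.
Proof. by rewrite (_ : q = v * (v - 3)) ?mulf_neq0 //; ring. Qed.

Lemma decim_factor_neq0 : decim_factor != 0.
Proof. by rewrite mulf_neq0 ?invr_neq0 ?mulf_neq0. Qed.

Lemma decim_deriv_neq0 : decim_deriv != 0.
Proof. by rewrite mulf_neq0 // expf_neq0 // mulf_neq0 ?invr_neq0. Qed.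

Let D_nat k : D k%:R = 0.
Proof.
have D1 : D 1 = 0.
  by have := DM 1 1; rewrite !mulr1 mul1r => /esym/(canRL (addrK _)); rewrite subrr.
elim: k => [|k IH]; last by rewrite -natr1 DD IH D1 addr0.
by have := DD 0 0; rewrite addr0 => /esym/(canRL (addrK _)); rewrite subrr.
Qed.

Let D_opp x : D (- x) = - D x.
Proof.
have /eqP := DD x (- x); rewrite subrr (D_nat 0) eq_sym addr_eq0.
by move=> /eqP ->; rewrite opprK.
Qed.

Lemma dlogM x y : x != 0 -> y != 0 -> dlog (x * y) = dlog x + dlog y.
Proof. by move=> x0 y0; rewrite /dlog DM; field; rewrite x0 y0. Qed.

Lemma dlogV x : x != 0 -> dlog x^-1 = - dlog x.
Proof.
move=> x0; apply/eqP; rewrite -addr_eq0 -dlogM ?invr_neq0 // mulVf //.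
by rewrite /dlog (D_nat 1) mul0r.
Qed.

Lemma dlogX x k : x != 0 -> dlog (x ^+ k) = k%:R * dlog x.
Proof.
move=> x0; elim: k => [|k IH]; first by rewrite /dlog expr0 (D_nat 1) !mul0r.
by rewrite exprS dlogM ?expf_neq0 // IH -natr1 mulrDl mul1r addrC.
Qed.

Lemma dlog_decim_factor : dlog decim_factor =
  - (v ^+ 2 / 4) * ((v + 1)^-1 + (v - 2)^-1 - (v + 2)^-1 - (v - 3)^-1).
Proof.
rewrite /decim_factor dlogM ?invr_neq0 ?mulf_neq0 // dlogV ?mulf_neq0 //.
rewrite !dlogM // /dlog !DD !D_opp !D_nat (D_nat 1) Dv oppr0 !addr0.
by field; rewrite v3' v2 v2' v1 (char0 3).
Qed.

Lemma dlog_decim_deriv : dlog decim_deriv =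
  - (v ^+ 2 / 4) * (2 / (2 * v - 3) + 2 / v - 2 * ((2 * v - 3) / q)).
Proof.
have e1 : dlog (2 * v - 3) = - (v ^+ 2 / 4) * (2 / (2 * v - 3)).
  by rewrite /dlog DD D_opp DM Dv !D_nat; field; rewrite v_half char0.
have e2 : dlog q = - (v ^+ 2 / 4) * ((2 * v - 3) / q).
  by rewrite /dlog DD D_opp !DM Dv !D_nat; field; rewrite q0 char0.
have e3 : dlog v = - (v ^+ 2 / 4) / v by rewrite /dlog Dv.
rewrite /decim_deriv dlogM ?expf_neq0 ?mulf_neq0 ?invr_neq0 // dlogX.
  by rewrite dlogM ?invr_neq0 // dlogV // e1 e2 e3; ring.
by rewrite mulf_neq0 ?invr_neq0.
Qed.

Lemma decim_no_primitive k s m : sg k = k ->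
  s = decim_deriv * sg s - k * dlog decim_factor - m%:R * dlog decim_deriv ->
  k = 0 /\ m = 0%N.
Proof.
rewrite dlog_decim_factor dlog_decim_deriv /decim_deriv => sk seq.
have := partial_fractions_gauge (char0 3) v0 v3' v1 v2' v2 v4' v1' v_half seq.
move=> gauge; apply: (no_residue sk (etrans gauge _)); congr (_ * _ + _).
by rewrite !(rmorph_nat, rmorphD, rmorphN, rmorphM, fmorphV, rmorphXn) /= sgv sk.
Qed.

(** Since [decim_deriv = (2 v - 3) v^2 / sg (v^2)], multiplying [k] by [(v^2)^(j+1)] leaves only the
    twist by [2 v - 3]. *)
Lemma decim_twist_deriv k j : sg k = decim_deriv ^+ j.+1 * k -> k = 0.
Proof.
move=> e; have /eqP : k * (v ^+ 2) ^+ j.+1 = 0.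
  apply: (@no_twist _ j); rewrite rmorphM !rmorphXn /= e sgv.
  have vE : v ^+ 2 = (v / q) ^+ 2 * q ^+ 2 by rewrite -exprMn divfK.
  rewrite {2}vE /decim_deriv 2![(_ * _) ^+ j.+1]exprMn.
  by move: (_ ^+ j.+1) (_ ^+ j.+1) (_ ^+ j.+1) => x y z; ring.
by rewrite mulf_eq0 !expf_eq0 /= (negPf v0) orbF => /eqP.
Qed.

(* The logarithmic derivative turns the multiplicative equation into the
   additive one. *)
Lemma decim_twist_factor k j : sg k = decim_factor ^+ j.+1 * k -> k = 0.
Proof.
move=> e; apply/eqP/negPn/negP => k0.
have f0 := decim_factor_neq0.
have [] := @decim_no_primitive j.+1%:R (dlog k) 0; first by rewrite rmorph_nat.
  rewrite mul0r subr0; have := congr1 dlog e.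
  rewrite dlogM ?expf_neq0 // dlogX // /dlog Dsg -mulrA -fmorphV -rmorphM.
  by move=> ->; rewrite addrC addKr.
by move/eqP; rewrite (negPf (char0 _)).
Qed.
End Decimation.

Lemma partial_fractions_cleared (F : fieldType) (n d n' d' w u a b : F) :
  d != 0 -> d' != 0 -> u != 0 -> w != 0 ->
  n / d = w * (n' / d') + (a / u + b / w) ->
  n * d' * (u * w) = w * n' * d * (u * w) + (a * w + b * u) * d * d'.
Proof.
move=> d0 d'0 u0 w0 /(canRL (divfK d0)) ->.
by field; rewrite d'0 u0 w0.
Qed.

(** * The field of rational functions in [v] *)

Section RationalFacts.
Variable R : realType.
Local Notation C := R[i].
Local Notation K := {fraction {poly C}}.
Definition frac_X : K := 'X%:F.
Definition frac_cst (c : C) : K := c%:P%:F.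

Fact frac_cst_zmod_morphism : zmod_morphism frac_cst.
Proof. by move=> x y; rewrite /frac_cst !raddfB. Qed.
Fact frac_cst_monoid_morphism : monoid_morphism frac_cst.
Proof. by split=> [|x y]; rewrite /frac_cst ?rmorph1 ?rmorphM. Qed.
HB.instance Definition _ :=
  GRing.isZmodMorphism.Build _ _ frac_cst frac_cst_zmod_morphism.
HB.instance Definition _ :=
  GRing.isMonoidMorphism.Build _ _ frac_cst frac_cst_monoid_morphism.

Lemma frac_scaleE a (p : {poly C}) : (a *: p)%:F = frac_cst a * p%:F.
Proof. by rewrite -mul_polyC tofracM. Qed.

Lemma frac_linearE a b :
  frac_cst a * frac_X + frac_cst b = (a *: 'X + b%:P)%:F.
Proof. by rewrite tofracD frac_scaleE. Qed.

Lemma frac_linear_neq0 a b : a != 0 -> frac_cst a * frac_X + frac_cst b != 0.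
Proof.
move=> a0; rewrite frac_linearE tofrac_eq0 -size_poly_eq0.
rewrite size_polyDl size_scale ?size_polyX //.
by rewrite (leq_ltn_trans (size_polyC_leq1 _)).
Qed.

Lemma frac_char0 k : k.+1%:R != 0 :> K.
Proof.
by have := fmorph_eq0 frac_cst k.+1%:R; rewrite rmorph_nat pnatr_eq0 => ->.
Qed.

Lemma frac_X_add k : frac_X + k%:R != 0.
Proof.
have := frac_linear_neq0 k%:R (oner_neq0 C).
by rewrite (rmorph_nat frac_cst) (rmorph1 frac_cst) mul1r.
Qed.

Lemma frac_X_sub k : frac_X - k%:R != 0.
Proof.
have := frac_linear_neq0 (- k%:R) (oner_neq0 C).
by rewrite (rmorphN frac_cst) (rmorph_nat frac_cst) (rmorph1 frac_cst) mul1r.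
Qed.

Lemma frac_X_half : 2 * frac_X - 3 != 0.
Proof.
have := @frac_linear_neq0 2 (- 3); rewrite pnatr_eq0 => /(_ isT).
by rewrite (rmorphN frac_cst) !(rmorph_nat frac_cst).
Qed.

Lemma quadE : (quad R)%:F = frac_X ^+ 2 - 3 * frac_X.
Proof.
by rewrite /quad tofracB tofracXn frac_scaleE (rmorph_nat frac_cst).
Qed.

Lemma quad_subst_X : quad_subst frac_X = frac_X ^+ 2 - 3 * frac_X.
Proof. by rewrite quad_subst_tofrac comp_polyX quadE. Qed.

Lemma quad_subst_cst c : quad_subst (frac_cst c) = frac_cst c.
Proof. by rewrite quad_subst_tofrac comp_polyC. Qed.

Lemma deriv_quadE : ((quad R)^`())%:F = 2 * frac_X - 3.
Proof.
rewrite deriv_quad; have := frac_linearE 2 (- 3).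
by rewrite polyCN (rmorphN frac_cst) !(rmorph_nat frac_cst) => ->.
Qed.

Lemma frac_no_twist (x : K) j : quad_subst x = (2 * frac_X - 3) ^+ j.+1 * x -> x = 0.
Proof. by rewrite -deriv_quadE; exact: quad_subst_twist_deriv_quad. Qed.

Lemma frac_no_residue (k U : K) m : quad_subst k = k ->
  U = (2 * frac_X - 3) * quad_subst U +
    (k / (frac_X - 1) + - 2 * m%:R / (2 * frac_X - 3)) ->
  k = 0 /\ m = 0%N.
Proof.
case/quad_subst_fixed => c ->; have [n [d [d0 cop ->]]] := frac_coprime U.
rewrite quad_subst_div //; have d'0 := comp_quad_neq0 d0 => e.
have dF : d%:F != 0 by rewrite tofrac_eq0.
have d'F : (d \Po quad R)%:F != 0 by rewrite tofrac_eq0.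
have {}e := partial_fractions_cleared dF d'F (frac_X_sub 1) frac_X_half e.
have e1 : ('X - 1%:P)%:F = frac_X - 1 by rewrite tofracB polyC1 tofrac1.
have e2 : (2 *: 'X - 3%:P)%:F = 2 * frac_X - 3.
  rewrite tofracB frac_scaleE (rmorph_nat frac_cst 2).
  by congr (_ - _); exact: (rmorph_nat frac_cst 3).
have bE : frac_cst (- 2 * m%:R) = - 2 * m%:R.
  by rewrite (rmorphM frac_cst) (rmorphN frac_cst) !(rmorph_nat frac_cst).
have [|c0 /eqP] := @no_residues R d n c (- 2 * m%:R) d0 cop.
- apply/eqP; rewrite -tofrac_eq; apply/eqP.
  move: e; rewrite -{}e1 -{}e2 -bE; move: (_ - 1%:P) (_ - 3%:P) => u w e.
  rewrite !(tofracM, tofracD) !frac_scaleE; exact: e.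
by rewrite mulf_eq0 oppr_eq0 !pnatr_eq0 => /eqP ->; rewrite c0 polyC0 tofrac0.
Qed.
End RationalFacts.

(** * Differential transcendence from a functional equation *)

Section Dehomogenization.
Variables (K : fieldType) (N : nat).

(* The substitution [Z_0 := X], [Z_j := X y_j] for [j > 0], where [X] is the
   variable of index [N] and [y_j] that of index [N - j]. *)
Definition dehom_var (j : 'I_N.+1) : {mpoly K[N.+1]} :=
  'X_ord_max * (if j == ord0 then 1 else 'X_(rev_ord j)).

Definition dehom_mnm (m : 'X_{1..N.+1}) : 'X_{1..N.+1} :=
  [multinom if i == ord_max then mdeg m else m (rev_ord i) | i < N.+1].

Lemma rev_ord_max : rev_ord (@ord_max N) = ord0.
Proof. by apply: val_inj; rewrite /= subnn. Qed.

Lemma rev_ord_eq0 (i : 'I_N.+1) : (rev_ord i == ord0) = (i == ord_max).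
Proof. by rewrite -(inj_eq rev_ord_inj) rev_ordK -rev_ord_max rev_ordK. Qed.

(** The exponent of [X] is the total degree, from which the missing exponent of [Z_0] is
    recovered. *)
Lemma dehom_mnm_inj : injective dehom_mnm.
Proof.
move=> m m' e; have em (i : 'I_N.+1) : i != ord0 -> m i = m' i.
  move=> i0; have /mnmP/(_ (rev_ord i)) := e; rewrite !mnmE rev_ordK.
  by rewrite -(inj_eq rev_ord_inj) rev_ordK rev_ord_max (negPf i0).
have /mnmP/(_ ord_max) := e; rewrite !mnmE eqxx !mdegE.
rewrite (bigD1 ord0) //= [in RHS](bigD1 ord0) //= (eq_bigr m') => [/addIn e0|//].
by apply/mnmP => i; have [->//|/em] := eqVneq i ord0.
Qed.

Lemma mmap1_dehom m : mmap1 dehom_var m = 'X_[dehom_mnm m].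
Proof.
have E i : dehom_mnm m i = if i == ord_max then mdeg m else m (rev_ord i).
  exact: mnmE.
rewrite /mmap1 mpolyXE_id [RHS](bigD1 ord_max) //= E eqxx mdegE.
under eq_bigr do rewrite exprMn; rewrite big_split /= prodrXr; congr (_ * _).
rewrite (reindex_inj rev_ord_inj) (bigD1 ord_max) //= rev_ord_max eqxx expr1n.
rewrite mul1r; apply: eq_bigr => i im.
by rewrite rev_ord_eq0 (negPf im) rev_ordK E (negPf im).
Qed.

Lemma dehom_neq0 (P : {mpoly K[N.+1]}) :
  P != 0 -> mmap (@mpolyC N.+1 K) dehom_var P != 0.
Proof.
move=> P0; apply: contraNneq P0 => /(congr1 (mcoeff (dehom_mnm (mlead P)))).
rewrite mcoeff0 /mmap raddf_sum /=.
under eq_bigr do rewrite mmap1_dehom mul_mpolyC mcoeffZ mcoeffX (inj_eq dehom_mnm_inj).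
have [//|P0] := eqVneq P 0.
rewrite (bigD1_seq (mlead P)) ?msupp_uniq ?mlead_supp //= eqxx mulr1.
rewrite big1 ?addr0 => [|m mP]; last by rewrite (negPf mP) mulr0.
by move/eqP; rewrite mleadc_eq0 (negPf P0).
Qed.
End Dehomogenization.

(** * Action of the substitution on the derivatives of [G] *)

Section Transcendence.
Variables (K L : fieldType) (iota : {rmorphism K -> L}).
Variables (sgK : {rmorphism K -> K}) (sgL : {rmorphism L -> L}).
Variables (DK : K -> K) (DL : L -> L) (f dp : K) (G : L).
Let a := DK f / f.
Let de := DK dp / dp.

Hypothesis char0 : forall k, k.+1%:R != 0 :> K.
Hypotheses (dp_neq0 : dp != 0) (f_neq0 : f != 0) (G_neq0 : G != 0).
Hypothesis DKM : forall x y, DK (x * y) = DK x * y + x * DK y.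
Hypothesis DLD : forall x y, DL (x + y) = DL x + DL y.
Hypothesis DLM : forall x y, DL (x * y) = DL x * y + x * DL y.
Hypothesis iota_sg : forall x, iota (sgK x) = sgL (iota x).
Hypothesis iota_D : forall x, iota (DK x) = DL (iota x).
Hypothesis D_sg : forall x, DL (sgL x) = iota dp * sgL (DL x).
Hypothesis GE : G = iota f * sgL G.
Hypothesis twist_dp : forall k j, sgK k = dp ^+ j.+1 * k -> k = 0.
Hypothesis twist_f : forall k j, sgK k = f ^+ j.+1 * k -> k = 0.
Hypothesis no_primitive : forall k s m, sgK k = k ->
  s = dp * sgK s - k * a - m%:R * de -> k = 0 /\ m = 0%N.

(** Coefficients of [sgL (G^(i)) = \sum_j der_coef i j G^(j)]. The case [i = 0] is the functional
    equation; the recursion differentiates this identity, and [D_sg] accounts for the division by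
    [dp]. *)
Fixpoint der_coef i j : K :=
  if i is i'.+1 then
    (DK (der_coef i' j) + (if j is j'.+1 then der_coef i' j' else 0)) / dp
  else if j is 0 then f^-1 else 0.

Let DL0 : DL 0 = 0.
Proof. by have := DLD 0 0; rewrite addr0 => /esym/(canRL (addrK _)); rewrite subrr. Qed.

Let DL_sum (I : Type) (r : seq I) (P : pred I) F :
  DL (\sum_(i <- r | P i) F i) = \sum_(i <- r | P i) DL (F i).
Proof. by apply: (big_morph DL DLD DL0). Qed.

Let DK0 : DK 0 = 0.
Proof. by apply: (fmorph_inj iota); rewrite iota_D !rmorph0 DL0. Qed.

Let DKN1 : DK 1 = 0.
Proof.
by have := DKM 1 1; rewrite !mulr1 mul1r => /esym/(canRL (addrK _)); rewrite subrr.
Qed.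

Lemma der_coef_gt i j : (i < j)%N -> der_coef i j = 0.
Proof.
elim: i j => [|i IH] [|j] //= ij.
by rewrite !IH ?DK0 ?addr0 ?mul0r // ltnW.
Qed.

Lemma der_inv x : x != 0 -> DK x^-1 = - (DK x / x) * x^-1.
Proof.
move=> x0; have := DKM x x^-1; rewrite divff // DKN1.
move/esym/(canRL (addKr _)); rewrite addr0 => e.
by rewrite -[LHS]mul1r -(mulVf x0) -mulrA e; field.
Qed.

Lemma der_expV i : DK (dp ^- i) = - (i%:R * de) * dp ^- i.
Proof.
elim: i => [|i IH]; first by rewrite expr0 invr1 DKN1 mul0r oppr0 mul0r.
rewrite exprS invfM DKM IH der_inv // -/de -natr1.
by move: (dp ^- i) => y; ring.
Qed.

Lemma der_coef_diag i : der_coef i i = f^-1 * dp ^- i.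
Proof.
elim: i => [|i IH] /=; first by rewrite expr0 invr1 mulr1.
by rewrite der_coef_gt // DK0 add0r IH exprSr invfM mulrA.
Qed.

Lemma der_coef_subdiag i : der_coef i.+1 i =
  - (i.+1%:R * a + 'C(i.+1, 2)%:R * de) * (f^-1 * dp ^- i.+1).
Proof.
elim: i => [|i IH].
  by rewrite /= addr0 der_inv // -/a expr1 mul1r mul0r addr0 mulrA.
rewrite [LHS]/= -/(der_coef i.+1 i) -/(der_coef i.+1 i.+1) IH der_coef_diag.
rewrite DKM der_inv // der_expV -/a (binS i.+1 1) bin1 natrD -[i.+2%:R]natr1.
by rewrite [dp ^+ i.+2]exprS invfM; move: (dp ^- i.+1) => y; ring.
Qed.

Lemma sgL_iter_der N i : (i <= N)%N ->
  sgL (iter i DL G) = \sum_(j < N.+1) iota (der_coef i j) * iter j DL G.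
Proof.
have idp : iota dp != 0 by rewrite fmorph_eq0.
elim: i => [|i IH] iN.
  rewrite big_ord_recl /= big1 ?addr0 => [|j _]; last by rewrite rmorph0 mul0r.
  by rewrite {2}GE mulrA -rmorphM mulVf // rmorph1 mul1r.
have -> : sgL (iter i.+1 DL G) = DL (sgL (iter i DL G)) / iota dp.
  by rewrite D_sg mulrC mulKf.
rewrite IH ?DL_sum; last exact: ltnW.
under eq_bigr do rewrite DLM -iota_D.
rewrite big_split /= mulrDl [in RHS]big_ord_recl /= addr0.
rewrite [X in X / _ + _]big_ord_recl [X in _ + X / _]big_ord_recr /=.
rewrite (der_coef_gt iN) rmorph0 mul0r addr0 mulrDl -addrA; congr (_ + _).
  by rewrite rmorphM fmorphV mulrAC.
rewrite -mulrDl -big_split mulr_suml; apply: eq_bigr => j _ /=.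
by rewrite rmorphM fmorphV rmorphD [RHS]mulrAC [in RHS]mulrDl.
Qed.

Theorem der_transcendental N (P : {mpoly K[N.+1]}) :
  P != 0 -> mmap iota (fun i : 'I_N.+1 => iter i DL G) P != 0.
Proof.
move=> P0; apply/negP => /eqP PG.
(* [A] and [e] describe [sgL (G^(i) / G)]: as [1 / sgL G = iota f / G], the coefficients are
   multiplied by [f], and the term in [G] itself becomes the constant part [e]. *)
pose A (i k : 'I_N.+1) : K := if (i < N)%N then
    if (k < N)%N then f * der_coef (N - i) (N - k) else 0
  else if (k < N)%N then 0 else f^-1.
pose e (i : 'I_N.+1) : K := if (i < N)%N then f * der_coef (N - i) 0 else 0.
pose u (i : 'I_N.+1) : L := if (i < N)%N then iter (N - i) DL G / G else G.
pose ev : {mpoly K[N.+1]} -> L := mmap iota u.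
have maxN (i : 'I_N.+1) : (i < N)%N = (i != ord_max).
  by rewrite -val_eqE /= ltn_neqAle -ltnS ltn_ord andbT.
have A_triangular (i k : 'I_N.+1) : (k < i)%N -> A i k = 0.
  rewrite /A => ki; have kN : (k < N)%N by apply: leq_trans ki _; rewrite -ltnS.
  case: ifP => iN; rewrite kN // der_coef_gt ?mulr0 //.
  by rewrite ltn_sub2l.
have A_last (i : 'I_N.+1) : (i < N)%N -> A i ord_max = 0.
  by rewrite /A => ->; rewrite ltnn.
have A_diag (i : 'I_N.+1) : (i < N)%N -> A i i = dp ^- (N - i).
  by rewrite /A => ->; rewrite der_coef_diag mulrA divff ?mul1r.
have A_subdiag (i k : 'I_N.+1) : (k < N)%N -> k = i.+1 :> nat ->
    A i k = - ((N - i)%:R * a + 'C(N - i, 2)%:R * de) * dp ^- (N - i).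
  move=> kN ki; have iN : (i < N)%N by rewrite (leq_trans _ kN) // ki.
  have Ni : (N - i = (N - k).+1)%N by rewrite ki subnSK.
  rewrite /A iN kN Ni der_coef_subdiag.
  by move: (_ + _) (_ ^- _) => x y; field.
have e_pred (i : 'I_N.+1) : i.+1 = N -> e i = - a / dp.
  move=> iN; have iN' : (i < N)%N by rewrite -[X in (_ < X)%N]iN.
  rewrite /e iN' -[X in (X - i)%N]iN subSnn (der_coef_subdiag 0) expr1 mul1r.
  by rewrite mul0r addr0; field; rewrite dp_neq0 f_neq0.
have A_max : A ord_max ord_max = f^-1 by rewrite /A ltnn.
have e_max : e ord_max = 0 by rewrite /e ltnn.
have A_diag0 (i : 'I_N.+1) : A i i != 0.
  have [/A_diag ->|] := boolP (i < N)%N; first by rewrite invr_neq0 ?expf_neq0.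
  by rewrite maxN negbK => /eqP ->; rewrite A_max invr_neq0.
have evX i : ev 'X_i = u i by rewrite /ev mmapX mmap1U.
have evC c : ev c%:MP = iota c by rewrite /ev mmapC.
have evD x y : ev (x + y) = ev x + ev y by rewrite /ev rmorphD.
have evM x y : ev (x * y) = ev x * ev y by rewrite /ev rmorphM.
have ev_form i : ev (affine_form A e i) = sgL (u i).
  rewrite /affine_form evD evC (big_morph ev evD (rmorph0 _)).
  under eq_bigr do rewrite -mul_mpolyC evM evC evX.
  have [iN|] := boolP (i < N)%N; last first.
    rewrite maxN negbK => /eqP ->; rewrite e_max rmorph0 addr0.
    rewrite (bigD1 ord_max) //= A_max big1 ?addr0 => [|k]; last first.
      by rewrite -maxN /A ltnn => ->; rewrite rmorph0 mul0r.
    rewrite /u ltnn {1}GE fmorphV mulrA mulVf ?mul1r //.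
    by rewrite fmorph_eq0.
  rewrite /u iN rmorphM fmorphV.
  rewrite (@sgL_iter_der N) ?leq_subr // [in RHS](reindex_inj rev_ord_inj) /=.
  rewrite (bigD1 ord_max) //= [in RHS](bigD1 ord_max) //=.
  rewrite A_last // rmorph0 mul0r add0r !subSS subnn /= addrC mulrDl.
  rewrite mulr_suml /e iN.
  have Ginv : (sgL G)^-1 = iota f / G.
    by rewrite {2}GE invfM mulrA divff ?mul1r // fmorph_eq0.
  rewrite !Ginv; congr (_ + _); last first.
    by rewrite rmorphM -mulrA [G * _]mulrC divfK // mulrC.
  apply: eq_bigr => k km; rewrite /A iN maxN km !subSS rmorphM.
  by rewrite [iota f * _]mulrC mulrACA.
have ev_tau Q : ev (affine_subst sgK A e Q) = sgL (ev Q).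
  elim/mpoly_gen_ind: Q => [c|i|P1 P2 e1 e2|P1 P2 e1 e2].
  - by rewrite affine_substC !evC iota_sg.
  - by rewrite affine_substX evX ev_form.
  - by rewrite rmorphD /= !evD rmorphD e1 e2.
  - by rewrite rmorphM /= !evM rmorphM e1 e2.
have [||Q [Q0 evQ siQ]] := @exists_semi_invariant _ sgK _ A e A_triangular
  A_diag0 _ (mmap iota u).
- by move=> Q evQ; apply: etrans (ev_tau Q) _; rewrite /ev evQ rmorph0.
(* Substituting [G^(j) = G y_j] turns the given relation into a nonzero one between [G] and the
   [y_j]. *)
- exists (mmap (@mpolyC N.+1 K) (@dehom_var K N) P); first exact: dehom_neq0.
  suff evd Q : ev (mmap (@mpolyC N.+1 K) (@dehom_var K N) Q) =
    mmap iota (fun i : 'I_N.+1 => iter i DL G) Q by exact: etrans (evd P) PG.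
  elim/mpoly_gen_ind: Q => [c|i|P1 P2 e1 e2|P1 P2 e1 e2].
  - by rewrite !mmapC evC.
  - rewrite !mmapX !mmap1U /dehom_var evM evX {1}/u ltnn.
    case: eqP => [->|/eqP i0]; first by rewrite /ev rmorph1 mulr1.
    rewrite evX /u maxN -(inj_eq rev_ord_inj) rev_ordK rev_ord_max i0 /= subSS.
    by rewrite subKn ?leq_ord // mulrC divfK.
  - by rewrite !rmorphD /= evD e1 e2.
  - by rewrite !rmorphM /= evM e1 e2.
have [q [m QE]] := semi_invariant_monomial char0 dp_neq0 f_neq0 A_triangular
  A_last A_diag A_subdiag e_pred A_max e_max twist_dp twist_f no_primitive Q0 siQ.
have evXn k : ev ('X_ord_max ^+ k) = G ^+ k.
  by rewrite /ev rmorphXn /= -/(ev 'X_ord_max) evX /u ltnn.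
have : ev Q = 0 by exact: evQ.
rewrite QE -mul_mpolyC evM evC evXn => /eqP.
rewrite mulf_eq0 fmorph_eq0 expf_eq0 (negPf G_neq0) andbF orbF.
by move=> /eqP q0; rewrite QE q0 scale0r eqxx in Q0.
Qed.
End Transcendence.

(** * Combinatorics of the Sierpinski graph *)

(* [sierpinski_fin n.+1] is the union of the complete graphs on [(a, b)],
   [(a + 1, b)], [(a, b + 1)] with [tri n a b]. *)
Fixpoint tri n (a b : int) : bool :=
  if n is m.+1 then
    [|| tri m a b, tri m (a - (2 ^ m)%N%:Z) b | tri m a (b - (2 ^ m)%N%:Z)]
  else (a == 0) && (b == 0).

Lemma triS n a b : tri n.+1 a b =
  [|| tri n a b, tri n (a - (2 ^ n)%N%:Z) b | tri n a (b - (2 ^ n)%N%:Z)].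
Proof. by []. Qed.

(** [tri n] holds for the pairs of naturals below [2^n] with no binary digit 1 in common. The
    definition adds the highest digit whereas the lowest one is split off here. *)
Lemma tri_binary n a b :
  [/\ tri n.+1 (2 * a) (2 * b) = tri n a b,
      tri n.+1 (2 * a + 1) (2 * b) = tri n a b,
      tri n.+1 (2 * a) (2 * b + 1) = tri n a b
    & tri n.+1 (2 * a + 1) (2 * b + 1) = false].
Proof.
elim: n a b => [|n IH] a b.
  by split; rewrite /= expn0; lia.
have E0 c : 2 * c - (2 ^ n.+1)%N%:Z = 2 * (c - (2 ^ n)%N%:Z) by rewrite expnS; lia.
have E1 c : 2 * c + 1 - (2 ^ n.+1)%N%:Z = 2 * (c - (2 ^ n)%N%:Z) + 1.
  by rewrite expnS; lia.
have [h1 h2 h3 h4] := IH a b.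
have [k1 k2 k3 k4] := IH (a - (2 ^ n)%N%:Z) b.
have [l1 l2 l3 l4] := IH a (b - (2 ^ n)%N%:Z).
split; rewrite (triS n.+1) ?E0 ?E1.
- by rewrite h1 k1 l1.
- by rewrite h2 k2 l2.
- by rewrite h3 k3 l3.
- by rewrite h4 k4 l4.
Qed.

Definition triangle (a b : int) : bool := asbool (exists n, tri n a b).

Lemma tri_ge0 n a b : tri n a b -> 0 <= a /\ 0 <= b.
Proof.
elim: n a b => [|n IH] a b /=; first by case/andP => /eqP-> /eqP->.
by case/or3P => /IH; lia.
Qed.

Lemma div2 (a : int) : exists c, a = 2 * c \/ a = 2 * c + 1.
Proof. by exists (a %/ 2)%Z; lia. Qed.

Lemma triangleP a b : reflect (exists n, tri n a b) (triangle a b).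
Proof. exact: asboolP. Qed.

Lemma triangle_binary a b :
  [/\ triangle (2 * a) (2 * b) = triangle a b,
      triangle (2 * a + 1) (2 * b) = triangle a b,
      triangle (2 * a) (2 * b + 1) = triangle a b
    & triangle (2 * a + 1) (2 * b + 1) = false].
Proof.
have incr n c d : tri n c d -> tri n.+1 c d by rewrite triS => ->.
have H c d : (forall n, tri n.+1 c d = tri n a b) -> triangle c d = triangle a b.
  move=> E; apply/triangleP/triangleP => -[n].
    by move/incr; rewrite E; exists n.
  by rewrite -E; exists n.+1.
split; [| | |apply/triangleP => -[n /incr]];
  first [apply: H => n|idtac]; by have [h1 h2 h3 h4] := tri_binary n a b; rewrite ?h4.
Qed.

Lemma triangle_ge0 a b : triangle a b -> 0 <= a /\ 0 <= b.
Proof. by case/triangleP => n /tri_ge0. Qed.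

Lemma triangle_lt0 a b : (a < 0) || (b < 0) -> triangle a b = false.
Proof. by move=> ab; apply/negP => /triangle_ge0; lia. Qed.

Lemma triangle00 : triangle 0 0. Proof. by apply/triangleP; exists 0%N. Qed.

(** Number of unit triangles of one half of the graph having [(a, b)] as a corner, each triangle
    being indexed by its lower left corner. *)
Definition corner_count a b : nat :=
  (triangle a b + triangle (a - 1) b + triangle a (b - 1))%N.

Lemma twice_pred (c : int) : 2 * c - 1 = 2 * (c - 1) + 1. Proof. lia. Qed.

Lemma corner_count_double a b :
  corner_count (2 * a) (2 * b) = corner_count a b.
Proof.
rewrite /corner_count; have [-> _ _ _] := triangle_binary a b.
have [_ h2 _ _] := triangle_binary (a - 1) b.
have [_ _ h3 _] := triangle_binary a (b - 1).
by rewrite !twice_pred h2 h3.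
Qed.

(** A vertex with an odd coordinate is the midpoint of a side of a triangle of side 2, and lies in
    two of its three unit triangles. *)
Lemma corner_count_odd a b : (a %% 2 != 0)%Z || (b %% 2 != 0)%Z ->
  corner_count a b = 0%N \/ corner_count a b = 2%N.
Proof.
have [c ac] := div2 a; have [d bd] := div2 b.
case: ac bd => -> [] -> odd; first by exfalso; lia.
all: rewrite /corner_count; have [h1 h2 h3 h4] := triangle_binary c d.
- have [_ _ _ k4] := triangle_binary (c - 1) d.
  by rewrite h3 twice_pred k4 addrK h1; case: triangle; [right|left].
- have [_ _ _ k4] := triangle_binary c (d - 1).
  by rewrite h2 twice_pred k4 addrK h1; case: triangle; [right|left].
- by rewrite h4 !addrK h2 h3; case: triangle; [right|left].
Qed.

(** Descent: halving both coordinates preserves the count, and away from the origin it ends at a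
    pair with an odd coordinate. *)
Lemma corner_count_neq0 a b : (a != 0) || (b != 0) ->
  corner_count a b = 0%N \/ corner_count a b = 2%N.
Proof.
have [m le_m] := ubnP (`|a| + `|b|)%N.
elim: m => // m IH in a b le_m *; move=> ab0.
have [|/norP[/negPn/eqP a2 /negPn/eqP b2]] :=
  boolP ((a %% 2 != 0)%Z || (b %% 2 != 0)%Z); first exact: corner_count_odd.
have -> : a = 2 * (a %/ 2)%Z by lia.
have -> : b = 2 * (b %/ 2)%Z by lia.
by rewrite corner_count_double; apply: IH; lia.
Qed.

Lemma corner_count0 : corner_count 0 0 = 1%N.
Proof. by rewrite /corner_count triangle00 !triangle_lt0. Qed.

(** The origin is a corner of one triangle in each half, and every other vertex lies in a single
    half. As each triangle brings two neighbours, this is 4-regularity. *)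
Lemma corner_count_opp a b : let c := (corner_count a b + corner_count (- a) (- b))%N in
  c = 0%N /\ (a != 0) || (b != 0) \/ c = 2%N.
Proof.
have [/andP[/eqP-> /eqP->]|] := boolP ((a == 0) && (b == 0)).
  by right; rewrite /= !oppr0 corner_count0.
rewrite negb_and => ab; have ge0 x y : corner_count x y != 0%N -> 0 <= x /\ 0 <= y.
  by rewrite /corner_count; case: (triangle x y) (@triangle_ge0 x y);
    case: (triangle (x - 1) y) (@triangle_ge0 (x - 1) y);
    case: (triangle x (y - 1)) (@triangle_ge0 x (y - 1)); lia.
have := corner_count_neq0 ab; have := @corner_count_neq0 (- a) (- b).
have := ge0 a b; have := ge0 (- a) (- b); rewrite !oppr_eq0 => /=.
by move: (corner_count a b) (corner_count (- a) (- b)); lia.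
Qed.

Definition up_neighbours (x : int * int) : seq (int * int) :=
  let: (a, b) := x in
  (if triangle a b then [:: (a + 1, b); (a, b + 1)] else [::]) ++
  (if triangle (a - 1) b then [:: (a - 1, b); (a - 1, b + 1)] else [::]) ++
  (if triangle a (b - 1) then [:: (a, b - 1); (a + 1, b - 1)] else [::]).

Definition neighbours (x : int * int) : seq (int * int) :=
  up_neighbours x ++ [seq - z | z <- up_neighbours (- x)].

Lemma size_up_neighbours a b :
  size (up_neighbours (a, b)) = (2 * corner_count a b)%N.
Proof. by rewrite /up_neighbours /corner_count !size_cat; do 3 case: triangle. Qed.

Lemma uniq_up_neighbours x : uniq (up_neighbours x).
Proof.
case: x => a b; rewrite /up_neighbours.
by do 3 case: triangle; rewrite /= ?inE -?pair_eqE /= /pair_eq /=; lia.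
Qed.

Lemma up_neighbours_ge0 x z : z \in up_neighbours x ->
  [/\ 0 <= x.1, 0 <= x.2, 0 <= z.1, 0 <= z.2 & x != z].
Proof.
case: x z => a b [c d]; rewrite /up_neighbours !mem_cat => zx.
case/or3P: zx; case: ifP => // T; have [? ?] := triangle_ge0 T.
all: rewrite !inE -!pair_eqE /pair_eq /= => zE; split; try lia.
all: by apply/negP => /andP; lia.
Qed.

Lemma uniq_neighbours x : uniq (neighbours x).
Proof.
rewrite cat_uniq uniq_up_neighbours map_inj_uniq ?uniq_up_neighbours; last first.
  exact: oppr_inj.
rewrite andbT; apply/hasPn => _ /mapP[z zx ->]; apply/negP => zx'.
have [/= h1 h2 h3 h4 h5] := up_neighbours_ge0 zx.
have [/= k1 k2 k3 k4 k5] := up_neighbours_ge0 zx'.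
case: x z h1 h2 h3 h4 h5 k1 k2 k3 k4 k5 {zx zx'} => a b [c d] /=.
by rewrite -pair_eqE /pair_eq /=; lia.
Qed.


Lemma size_neighboursE a b : size (neighbours (a, b)) =
  (2 * (corner_count a b + corner_count (- a) (- b)))%N.
Proof. by rewrite /neighbours size_cat size_map !size_up_neighbours mulnDr. Qed.

Lemma size_neighbours_mem x z : z \in neighbours x -> size (neighbours x) = 4%N.
Proof.
case: x => a b zx; have : size (neighbours (a, b)) != 0%N.
  by case: neighbours zx.
by rewrite size_neighboursE; have := corner_count_opp a b => /=; lia.
Qed.

Lemma sierpinski_finE n x y : sierpinski_fin n.+1 x y <->
  exists a b, tri n a b /\
    complete [:: (0, 0); (1, 0); (0, 1)] (x - (a, b)) (y - (a, b)).
Proof.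
elim: n x y => [|n IH] x y.
  split=> [xy|[a [b [/andP[/eqP-> /eqP->]]]]]; last by rewrite !subr0.
  by exists 0, 0; rewrite !subr0.
have -> : sierpinski_fin n.+2 x y = [|| sierpinski_fin n.+1 x y,
    translate ((2 ^ n)%N%:Z, 0) (sierpinski_fin n.+1) x y
  | translate (0, (2 ^ n)%N%:Z) (sierpinski_fin n.+1) x y] by [].
rewrite /translate; set k := (2 ^ n)%N%:Z.
have E (z : int * int) a b c d : z - (c, d) - (a, b) = z - (a + c, b + d).
  by rewrite -addrA -opprD [(c, d) + _]addrC.
split.
  case/or3P => /IH[a [b [ab xy]]].
  - by exists a, b; rewrite triS ab.
  - exists (a + k), (b + 0); rewrite -!E; split=> //.
    by rewrite triS addrK addr0 ab orbT.
  - exists (a + 0), (b + k); rewrite -!E; split=> //.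
    by rewrite triS addrK addr0 ab !orbT.
case=> a [b []]; rewrite triS => /or3P[] ab xy; apply/or3P.
- by apply: Or31; apply/IH; exists a, b.
- by apply: Or32; apply/IH; exists (a - k), b; rewrite !E subrK addr0.
- by apply: Or33; apply/IH; exists a, (b - k); rewrite !E subrK addr0.
Qed.

Lemma up_neighboursP x y : y \in up_neighbours x <->
  exists n, sierpinski_fin n x y.
Proof.
(* The single edge [S_0] is not a union of triangles, so edges are pushed to the next level. *)
have mono n : sierpinski_fin n x y -> sierpinski_fin n.+1 x y.
  case: n => [|n]; last by move=> h; apply/or3P/Or31.
  by rewrite /= /complete !inE => /and3P[-> /orP[->|->] /orP[->|->]]; rewrite ?orbT.
case: x y mono => a b [c d] mono.
have P (e f : int) : reflect (exists n, tri n e f) (triangle e f) by exact: triangleP.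
split=> [|[n /mono/sierpinski_finE[e [f []]]]].
  rewrite /up_neighbours !mem_cat.
  case/or3P; case: P => // -[n ef]; rewrite !inE -!pair_eqE /pair_eq /= => cd;
    exists n.+1; apply/sierpinski_finE; [exists a, b|exists (a - 1), b|exists a, (b - 1)];
    split=> //; rewrite /complete !inE -!pair_eqE /pair_eq /=; lia.
move=> ef; have {}ef : triangle e f by apply/triangleP; exists n.
rewrite /complete !inE -!pair_eqE /pair_eq /= => xy.
rewrite /up_neighbours !mem_cat.
have [[ea fb]|[[ea fb]|[ea fb]]] :
  (e = a /\ f = b) \/ (e = a - 1 /\ f = b) \/ (e = a /\ f = b - 1) by lia.
- by rewrite ea fb in ef xy; rewrite ef !inE -!pair_eqE /pair_eq /=; lia.
- by rewrite ea fb in ef xy; rewrite ef !inE -!pair_eqE /pair_eq /=; lia.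
- by rewrite ea fb in ef xy; rewrite ef !inE -!pair_eqE /pair_eq /=; lia.
Qed.

Lemma neighboursP x y : sierpinski x y <-> y \in neighbours x.
Proof.
rewrite mem_cat -{3}[y]opprK (mem_map oppr_inj); split.
  by case=> n [h|h]; apply/orP; [left|right]; apply/up_neighboursP; exists n.
by case/orP => /up_neighboursP[n h]; exists n; [left|right].
Qed.

Lemma sierpinski_sym x y : sierpinski x y -> sierpinski y x.
Proof.
have complete_sym vs u w : complete vs u w = complete vs w u.
  by rewrite /complete eq_sym [(u \in vs) && _]andbC.
have fin_sym n u w : sierpinski_fin n u w -> sierpinski_fin n w u.
  case: n => [|n]; first by rewrite /= complete_sym.
  move/sierpinski_finE => [a [b [ab uw]]]; apply/sierpinski_finE; exists a, b.
  by rewrite complete_sym.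
by case=> n [h|h]; exists n; [left|right]; exact: fin_sym.
Qed.

Section Walk.
Variable R : realType.

Lemma degree_sierpinski x y : y \in neighbours x -> degree sierpinski x = 4%N.
Proof.
move=> yx; rewrite /degree -(size_neighbours_mem yx).
have -> : (fun z => sierpinski x z) =
    (fun z => is_true (z \in seq_fset tt (neighbours x))).
  by apply/funext => z; apply/propext; rewrite seq_fsetE; exact: neighboursP.
by rewrite set_fsetK size_seq_fset undup_id ?uniq_neighbours.
Qed.

Lemma srw_step_sierpinski z y : srw_step R sierpinski z y =
  if z \in neighbours y then 4^-1 else 0.
Proof.
rewrite /srw_step; have -> : asbool (sierpinski z y) = (z \in neighbours y).
  by apply/asboolP/idP => [/sierpinski_sym|] /neighboursP // /sierpinski_sym.
case: ifP => // /neighboursP/sierpinski_sym/neighboursP zy.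
by rewrite (degree_sierpinski zy).
Qed.

Lemma srw_prob_sierpinskiS n x y : srw_prob R sierpinski n.+1 x y =
  4^-1 * \sum_(z <- neighbours y) srw_prob R sierpinski n x z.
Proof.
rewrite [LHS]/= (fsbigE (neighbours y)) ?uniq_neighbours //; last first.
  by move=> z _ zy; rewrite srw_step_sierpinski (negPf zy) mulr0.
rewrite mulr_sumr big_seq_cond [RHS]big_seq_cond.
apply: eq_big => [z|z /andP[zy _]]; first by rewrite classical_sets.in_setT.
by rewrite srw_step_sierpinski zy mulrC.
Qed.
End Walk.

(** * Decimation of the Green function *)

Section Decimation.
Variables (S : idomainType) (t : S).
Hypothesis two_neq0 : (2 : S) != 0.
Implicit Types g : int * int -> S.
#[local] Arguments up_neighbours : simpl never.

(** Equation of the Green function with source at the origin, multiplied by 4. A lattice point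
    outside the graph has no neighbours, and there it only says that [4 * g x = 0]. *)
Definition green g := forall x,
  4 * g x = 4 * (x == 0)%:R + t * \sum_(z <- neighbours x) g z.

Lemma sum_neighbours g x : \sum_(z <- neighbours x) g z =
  \sum_(z <- up_neighbours x) g z + \sum_(z <- up_neighbours (- x)) g (- z).
Proof. by rewrite [LHS]big_cat; congr (_ + _); exact: big_map. Qed.

Lemma green_opp g : green g -> green (g \o -%R).
Proof.
move=> gg x /=; rewrite gg oppr_eq0; congr (_ + _ * _).
rewrite !sum_neighbours opprK addrC; congr (_ + _).
by apply: eq_bigr => z _ /=; rewrite opprK.
Qed.

(** [m1], [m2], [m3] are the values at the midpoints of the sides [AB], [AC], [BC] of a triangle of
    side 2, and [m1 + m2] is the contribution of the triangle to the neighbours of [A]. Eliminating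
    [m3] yields twice the identity, whence [two_neq0]. *)
Lemma midpoints (A B C m1 m2 m3 : S) :
  4 * m1 = t * (A + B + m2 + m3) -> 4 * m2 = t * (A + C + m1 + m3) ->
  4 * m3 = t * (B + C + m1 + m2) ->
  ((4 + t) * (2 - t)) * (m1 + m2) = t * (4 * A + (2 + t) * (B + C)).
Proof.
move=> e1 e2 e3; apply: (mulfI two_neq0).
transitivity (4 * (4 * m1 + 4 * m2) - t * 4 * (m1 + m2) - 2 * t ^+ 2 * (m1 + m2)).
  by ring.
rewrite e1 e2; transitivity (t * (8 * A + 4 * (B + C)) + 2 * t * (4 * m3)
  - 2 * t ^+ 2 * (m1 + m2)); first by ring.
by rewrite e3; ring.
Qed.

(** A midpoint is never the origin and has its four neighbours inside its triangle of side 2, so the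
    three equations form a closed system. *)
Lemma green_midpoints g a b : green g -> triangle a b ->
  let A := g (2 * a, 2 * b) in let B := g (2 * (a + 1), 2 * b) in
  let C := g (2 * a, 2 * (b + 1)) in
  let m1 := g (2 * a + 1, 2 * b) in let m2 := g (2 * a, 2 * b + 1) in
  let m3 := g (2 * a + 1, 2 * b + 1) in
  [/\ 4 * m1 = t * (A + B + m2 + m3), 4 * m2 = t * (A + C + m1 + m3)
    & 4 * m3 = t * (B + C + m1 + m2)].
Proof.
move=> gg T; have [a0 b0] := triangle_ge0 T => /=.
have [h1 h2 h3 h4] := triangle_binary a b.
have [_ _ _ k4] := triangle_binary (a - 1) b.
have [_ _ _ l4] := triangle_binary a (b - 1).
have neg c d : (c < 0) || (d < 0) -> up_neighbours (c, d) = [::].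
  by move=> cd; rewrite /up_neighbours !triangle_lt0 //; lia.
have nbE c d : (0 < c) || (0 < d) -> neighbours (c, d) = up_neighbours (c, d).
  move=> cd; rewrite /neighbours (_ : up_neighbours (- (c, d)) = [::]) ?cats0 //.
  by apply: (neg (- c) (- d)); lia.
have dS (c : int) : 2 * (c + 1) = 2 * c + 1 + 1 by lia.
split; rewrite gg nbE; try (by lia).
- rewrite /up_neighbours h2 addrK h1 twice_pred l4 T !big_cons big_nil /= dS.
  rewrite (_ : (_ == 0) = false); last by rewrite -pair_eqE /pair_eq /=; lia.
  by rewrite mulr0n; ring.
- rewrite /up_neighbours h3 addrK h1 twice_pred k4 T !big_cons big_nil /= dS.
  rewrite (_ : (_ == 0) = false); last by rewrite -pair_eqE /pair_eq /=; lia.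
  by rewrite mulr0n; ring.
- rewrite /up_neighbours h4 !addrK h2 h3 T !big_cons big_nil /= !dS.
  rewrite (_ : (_ == 0) = false); last by rewrite -pair_eqE /pair_eq /=; lia.
  by rewrite mulr0n; ring.
Qed.

Definition twice (x : int * int) : int * int := (2 * x.1, 2 * x.2).

(** Sum of [midpoints] over the triangles of side 2 with a corner at [twice (a, b)]; each
    contributes the value at that corner once, whence [corner_count]. *)
Lemma green_up_neighbours g a b : green g ->
  (4 + t) * (2 - t) * \sum_(z <- up_neighbours (twice (a, b))) g z =
  t * (4 * (corner_count a b)%:R * g (twice (a, b)) +
       (2 + t) * \sum_(z <- up_neighbours (a, b)) g (twice z)).
Proof.
move=> gg; rewrite /twice /up_neighbours /corner_count /=.
have [h1 _ _ _] := triangle_binary a b.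
have [_ k2 _ _] := triangle_binary (a - 1) b.
have [_ _ l3 _] := triangle_binary a (b - 1).
rewrite !twice_pred h1 k2 l3 !big_cat /=; set e := (4 + t) * (2 - t).
rewrite 2!(mulrDr e) !natrD.
set T1 := triangle a b; set T2 := triangle (a - 1) b; set T3 := triangle a (b - 1).
have E1 : e * (\sum_(z <- if T1 then
      [:: (2 * a + 1, 2 * b); (2 * a, 2 * b + 1)] else [::]) g z) =
    t * (4 * T1%:R * g (2 * a, 2 * b) + (2 + t) *
     \sum_(z <- if T1 then [:: (a + 1, b); (a, b + 1)] else [::]) g (2 * z.1, 2 * z.2)).
  rewrite /T1; case: ifP => T; last by rewrite !big_nil mulr0n; ring.
  have [e1 e2 e3] := green_midpoints gg T.
  by rewrite /e !big_cons !big_nil /= !addr0 (midpoints e1 e2 e3); ring.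
have E2 : e * (\sum_(z <- if T2 then
      [:: (2 * (a - 1) + 1, 2 * b); (2 * (a - 1) + 1, 2 * b + 1)] else [::]) g z) =
    t * (4 * T2%:R * g (2 * a, 2 * b) + (2 + t) *
     \sum_(z <- if T2 then [:: (a - 1, b); (a - 1, b + 1)] else [::]) g (2 * z.1, 2 * z.2)).
  rewrite /T2; case: ifP => T; last by rewrite !big_nil mulr0n; ring.
  have := green_midpoints gg T; rewrite /= subrK => -[e1 e2 e3].
  rewrite /e !big_cons !big_nil /= !addr0 (@midpoints (g (2 * a, 2 * b))
    (g (2 * (a - 1), 2 * b)) (g (2 * (a - 1), 2 * (b + 1))) _ _
    (g (2 * (a - 1), 2 * b + 1))).
  - by ring.
  - by rewrite e1; ring.
  - by rewrite e3; ring.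
  - by rewrite e2; ring.
have E3 : e * (\sum_(z <- if T3 then
      [:: (2 * a, 2 * (b - 1) + 1); (2 * a + 1, 2 * (b - 1) + 1)] else [::]) g z) =
    t * (4 * T3%:R * g (2 * a, 2 * b) + (2 + t) *
     \sum_(z <- if T3 then [:: (a, b - 1); (a + 1, b - 1)] else [::]) g (2 * z.1, 2 * z.2)).
  rewrite /T3; case: ifP => T; last by rewrite !big_nil mulr0n; ring.
  have := green_midpoints gg T; rewrite /= subrK => -[e1 e2 e3].
  rewrite /e !big_cons !big_nil /= !addr0 (@midpoints (g (2 * a, 2 * b))
    (g (2 * a, 2 * (b - 1))) (g (2 * (a + 1), 2 * (b - 1))) _ _
    (g (2 * a + 1, 2 * (b - 1)))).
  - by ring.
  - by rewrite e2; ring.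
  - by rewrite e3; ring.
  - by rewrite e1; ring.
by rewrite E1 E2 E3; move: (\sum_(_ <- _) _) (\sum_(_ <- _) _) (\sum_(_ <- _) _) => *; ring.
Qed.

(** A vertex lies in two triangles, so eliminating midpoints brings back [8 t^2 g (twice x)]; the
    factor on the left is [(4 + t)(2 - t) - 2 t^2 = (2 + t)(4 - 3 t)]. *)
Lemma green_decimation g : green g -> forall x,
  (2 + t) * (4 - 3 * t) * (4 * g (twice x)) =
  (4 + t) * (2 - t) * (4 * (x == 0)%:R) +
  t ^+ 2 * (2 + t) * \sum_(z <- neighbours x) g (twice z).
Proof.
move=> gg [a b].
have twiceN x : twice (- x) = - twice x by case: x => c d; rewrite /twice /= !mulrN.
have tw0 : (twice (a, b) == 0) = ((a, b) == 0).
  by rewrite /twice -!pair_eqE /pair_eq /=; lia.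
have e0 := gg (twice (a, b)); rewrite tw0 in e0.
have up1 := green_up_neighbours a b gg.
have up2 := green_up_neighbours (- a) (- b) (green_opp gg).
have twN : twice (- a, - b) = - twice (a, b) by rewrite -twiceN.
rewrite twN /= opprK in up2.
have [[c0 ab]|c2] := corner_count_opp a b.
  have nb0 : neighbours (a, b) = [::].
    by apply: size0nil; rewrite size_neighboursE c0.
  have nb0' : neighbours (twice (a, b)) = [::].
    apply: size0nil; rewrite size_neighboursE -!mulrN !corner_count_double.
    by rewrite c0.
  have x0 : ((a, b) == 0) = false.
    by rewrite -pair_eqE /pair_eq /=; lia.
  by rewrite e0 nb0 nb0' x0 !big_nil mulr0n; ring.
have N1 : (4 + t) * (2 - t) * \sum_(z <- neighbours (twice (a, b))) g z =
    t * (8 * g (twice (a, b)) + (2 + t) * \sum_(z <- neighbours (a, b)) g (twice z)).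
  rewrite !sum_neighbours mulrDr up1.
  rewrite [X in _ + X]up2.
  have -> : \sum_(z <- up_neighbours (- (a, b))) g (twice (- z)) =
    \sum_(z <- up_neighbours (- a, - b)) g (- twice z).
    by apply: eq_bigr => z _; rewrite twiceN.
  have -> : 8 = 4 * (corner_count a b)%:R + 4 * (corner_count (- a) (- b))%:R :> S.
    by rewrite -mulrDr -natrD c2 -natrM.
  by ring.
transitivity ((4 + t) * (2 - t) * (4 * g (twice (a, b))) - t ^+ 2 * (8 * g (twice (a, b)))).
  by ring.
rewrite {1}e0 mulrDr [X in _ + X - _]mulrCA N1; ring.
Qed.
End Decimation.

Lemma decimation_difference (S : comNzRingType) (u d s1 s2 g1 g2 de : S) :
  (2 + u) * (4 - 3 * u) * (4 * g1) =
    (4 + u) * (2 - u) * (4 * de) + u ^+ 2 * (2 + u) * s1 ->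
  4 * g2 = 4 * de + d * s2 ->
  (4 - 3 * u) * d = u ^+ 2 ->
  4 * ((4 - 3 * u) *
    ((2 + u) * (4 - 3 * u) * g1 - (4 + u) * (2 - u) * g2)) =
  u ^+ 2 * ((2 + u) * (4 - 3 * u) * s1 - (4 + u) * (2 - u) * s2).
Proof.
move=> e1 e2 e3.
transitivity ((4 - 3 * u) * ((2 + u) * (4 - 3 * u) * (4 * g1)) -
  (4 + u) * (2 - u) * ((4 - 3 * u) * (4 * g2))); first by ring.
rewrite e1 e2.
transitivity ((4 - 3 * u) * (u ^+ 2 * (2 + u) * s1) -
  (4 + u) * (2 - u) * ((4 - 3 * u) * d * s2)); first by ring.
by rewrite e3; ring.
Qed.

(** * The functional equation of the return generating function *)

Section FunctionalEquation.
Variable R : realType.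
Local Notation C := R[i].
Definition fps_X : fps C := fps_of_poly 'X.
Local Notation t := fps_X.

Lemma fps_natM k (f : fps C) n : (k%:R * f) n = k%:R * f n.
Proof. by rewrite -(rmorph_nat (@fps_cst C)) fps_cstM. Qed.

Lemma fps_nat k n : (k%:R : fps C) n = if n is 0 then k%:R else 0.
Proof.
rewrite -[k%:R in LHS]mulr1 fps_natM fps_coef1.
by case: n => [|n]; rewrite ?mulr1 ?mulr0.
Qed.

Lemma fps_XM (f : fps C) n : (t * f) n = if n is m.+1 then f m else 0.
Proof.
rewrite fps_coefM; case: n => [|n]; first by rewrite big_ord1 /= coefX mul0r.
rewrite !big_ord_recl /= !coefX mul0r add0r mul1r subSS subn0 big1 ?addr0 //.
by move=> i _; rewrite coefX mul0r.
Qed.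

Definition green_fps (x : int * int) : fps C :=
  Fps (fun n => (srw_prob R sierpinski n (0, 0) x)%:C%C).

Lemma green_fpsP : green t green_fps.
Proof.
move=> x; apply/fpsP => -[|n].
  rewrite fps_natM fps_coefD fps_XM addr0 fps_natM fps_nat /= eq_sym.
  by rewrite (rmorph_nat (real_complex R)).
rewrite fps_natM fps_coefD fps_XM fps_natM fps_nat mulr0 add0r fps_coef_sum.
rewrite [X in 4 * X]/= -/(srw_prob R sierpinski n.+1 _ _) srw_prob_sierpinskiS.
rewrite (rmorphM (real_complex R)) fmorphV (rmorph_nat (real_complex R)).
by rewrite mulVKf ?pnatr_eq0 // (rmorph_sum (real_complex R)).
Qed.

(** Uniqueness of Green functions: [4 - 3 t] has nonzero constant term and the right-hand side
    carries [t^2], so the coefficients of index [n] vanish by induction on [n], at all points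
    simultaneously. *)
Lemma fps_harmonic_eq0 (w : int * int -> fps C) :
  (forall x, 4 * ((4 - 3 * t) * w x) = t ^+ 2 * \sum_(z <- neighbours x) w z) ->
  forall x, w x = 0.
Proof.
move=> weq x; apply/fpsP => n; rewrite fps_coef0.
have [m] := ubnP n; elim: m => // m IH in n x *; rewrite ltnS => nm.
have : (4 * ((4 - 3 * t) * w x)) n = (t ^+ 2 * \sum_(z <- neighbours x) w z) n.
  by rewrite weq.
rewrite mulrBl -mulrA expr2 -mulrA fps_natM fps_coefD fps_coefN !fps_natM !fps_XM.
have -> : (if n is k.+1 then w x k else 0) = 0.
  by case: n nm => // k km; rewrite IH.
have -> : (if n is k.+1 then (t * \sum_(z <- neighbours x) w z) k else 0) = 0.
  case: n nm => // n nm; rewrite fps_XM; case: n nm => // n nm.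
  by rewrite fps_coef_sum big1 // => z _; rewrite IH // ltnW.
rewrite mulr0 subr0 => /eqP.
by rewrite !mulf_eq0 !pnatr_eq0 => /eqP.
Qed.

(** Geometric expansion of [t^2 / (4 - 3 t)]. *)
Definition decim_fps : fps C :=
  Fps (fun n => if n is m.+2 then 4^-1 * (3 / 4) ^+ m else 0).

Lemma decim_fpsE : (4 - 3 * t) * decim_fps = t ^+ 2.
Proof.
apply/fpsP => n; rewrite mulrBl -mulrA fps_coefD fps_coefN !fps_natM fps_XM.
rewrite expr2 fps_XM; case: n => [|[|[|n]]] /=.
- by rewrite !mulr0 subr0.
- by rewrite !mulr0 subr0 coefX.
- by rewrite mulr0 subr0 expr0 mulr1 coefX mulfV // pnatr_eq0.
- by rewrite coefX mulr0n exprS; move: (_ ^+ n) => y; field.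
Qed.

Lemma decim_fps0 : decim_fps 0 = 0. Proof. by []. Qed.

Lemma fps_comp_X : fps_comp decim_fps0 t = decim_fps.
Proof. by rewrite fps_comp_poly /fps_horner map_polyX hornerX. Qed.

Lemma green_decim_comp : green decim_fps (fps_comp decim_fps0 \o green_fps).
Proof.
move=> x /=; have := congr1 (fps_comp decim_fps0) (green_fpsP x).
by rewrite rmorphD !rmorphM !rmorph_nat /= fps_comp_X rmorph_sum.
Qed.

Lemma green_fps_twice x : (2 + t) * (4 - 3 * t) * green_fps (twice x) =
  (4 + t) * (2 - t) * fps_comp decim_fps0 (green_fps x).
Proof.
apply/eqP; rewrite -subr_eq0; apply/eqP.
pose w x := (2 + t) * (4 - 3 * t) * green_fps (twice x) -
  (4 + t) * (2 - t) * fps_comp decim_fps0 (green_fps x).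
apply: (@fps_harmonic_eq0 w) => {}x.
have n2 : (2 : fps C) != 0.
  apply/eqP => /fpsP/(_ 0); rewrite fps_nat => /eqP.
  by rewrite fps_coef0 pnatr_eq0.
have e1 := green_decimation n2 green_fpsP x.
have e2 := green_decim_comp x; rewrite [LHS]/= in e2.
have -> : \sum_(z <- neighbours x) w z =
    (2 + t) * (4 - 3 * t) * \sum_(z <- neighbours x) green_fps (twice z) -
    (4 + t) * (2 - t) * \sum_(z <- neighbours x) (fps_comp decim_fps0 \o green_fps) z.
  by rewrite sumrB -!mulr_sumr.
exact: decimation_difference e1 e2 decim_fpsE.
Qed.

Lemma return_gfE : (2 + t) * (4 - 3 * t) * return_gf R =
  (4 + t) * (2 - t) * fps_comp decim_fps0 (return_gf R).
Proof. exact: (green_fps_twice (0, 0)). Qed.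

Lemma return_gf_neq0 : return_gf R != 0.
Proof.
apply/eqP => /fpsP/(_ 0) /eqP; rewrite fps_coef0 /= /return_prob /= ?eqxx.
by rewrite (rmorph1 (real_complex R)) oner_eq0.
Qed.
End FunctionalEquation.

(** * Embedding of the rational functions in the Laurent series *)

Section PolyEvaluation.
Variables (C : closedFieldType) (F : fieldType) (j : {rmorphism C -> F}) (x : F).
Definition poly_ev of (forall r, x != j r) := fun p : {poly C} => (map_poly j p).[x].
Hypothesis x_transc : forall r, x != j r.
Local Notation ev := (poly_ev x_transc).

Fact poly_ev_zmod_morphism : zmod_morphism ev.
Proof. by move=> p q; rewrite /poly_ev rmorphB hornerD hornerN. Qed.
Fact poly_ev_monoid_morphism : monoid_morphism ev.
Proof.
by split=> [|p q]; rewrite /poly_ev ?rmorph1 ?hornerC // rmorphM hornerM.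
Qed.
HB.instance Definition _ :=
  GRing.isZmodMorphism.Build _ _ ev poly_ev_zmod_morphism.
HB.instance Definition _ :=
  GRing.isMonoidMorphism.Build _ _ ev poly_ev_monoid_morphism.

Lemma poly_evC c : ev c%:P = j c.
Proof. by rewrite /poly_ev map_polyC hornerC. Qed.

Lemma poly_evX : ev 'X = x.
Proof. by rewrite /poly_ev map_polyX hornerX. Qed.

(** Over an algebraically closed field [p] splits into linear factors, so it is enough that [x]
    differs from every constant. *)
Lemma poly_ev_inj : injective ev.
Proof.
apply: raddf_inj => p /= p0; apply/eqP/negPn/negP => pn0.
have [r pE] := closed_field_poly_normal p; have/eqP := p0; rewrite pE.
rewrite -mul_polyC (rmorphM ev) /= poly_evC mulf_eq0 fmorph_eq0.
rewrite lead_coef_eq0 (negPf pn0) /= (rmorph_prod ev) /= prodf_seq_eq0.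
case/hasP => z _; rewrite (rmorphB ev) /= poly_evX poly_evC subr_eq0.
by rewrite (negPf (x_transc z)).
Qed.
End PolyEvaluation.

Lemma frac_rmorph_eq (R : idomainType) (F : fieldType)
    (u w : {rmorphism {fraction R} -> F}) :
  (forall a, u a%:F = w a%:F) -> u =1 w.
Proof.
by move=> uw x; rewrite (frac_numden x) !fmorph_div !uw.
Qed.

Lemma poly_rmorph_eq (C : nzRingType) (S : nzRingType) (u w : {rmorphism {poly C} -> S}) :
  (forall c, u c%:P = w c%:P) -> u 'X = w 'X -> u =1 w.
Proof.
move=> uwC uwX; elim/poly_ind => [|p c IH]; first by rewrite !rmorph0.
by rewrite !rmorphD !rmorphM IH uwC uwX.
Qed.

(** For the difference [E] of two derivations along [u], this is uniqueness of the extension to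
    fractions: the Leibniz rule applied to [x] times its denominator determines [E x]. *)
Lemma frac_derivation_eq0 (R : idomainType) (F : fieldType)
    (u : {rmorphism {fraction R} -> F}) (E : {fraction R} -> F) :
  (forall x y, E (x * y) = E x * u y + u x * E y) ->
  (forall a, E a%:F = 0) -> forall x, E x = 0.
Proof.
move=> EM E0 x; have d0 : (\d_(repr x))%:F != 0.
  by rewrite tofrac_eq0; exact: denom_ratioP.
have := EM x (\d_(repr x))%:F; rewrite {1}[x]frac_numden divfK // !E0 mulr0 addr0.
by move/esym/eqP; rewrite mulf_eq0 fmorph_eq0 (negPf d0) orbF => /eqP.
Qed.

Lemma poly_derivation_eq0 (C : nzRingType) (S : nzRingType)
    (u : {rmorphism {poly C} -> S}) (E : {poly C} -> S) :
  (forall p q, E (p + q) = E p + E q) ->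
  (forall p q, E (p * q) = E p * u q + u p * E q) ->
  (forall c, E c%:P = 0) -> E 'X = 0 -> forall p, E p = 0.
Proof.
move=> ED EM EC EX; elim/poly_ind => [|p c IH]; first by rewrite -polyC0 EC.
by rewrite ED EM IH EC EX mul0r mulr0 !addr0.
Qed.

Lemma field_derivation_quot (F : fieldType) (D : F -> F) (x y z : F) :
  (forall a b, D (a * b) = D a * b + a * D b) ->
  D z = 0 -> y != 0 -> x = z / y -> D x = - (x * D y / y).
Proof.
move=> DM z0 y0 e; have ez : x * y = z by rewrite e divfK.
have : D (x * y) = 0 by rewrite ez.
rewrite DM => /eqP; rewrite addr_eq0 => /eqP e2.
by rewrite -mulNr -e2 mulfK.
Qed.

Lemma decimation_inverse (F : fieldType) (x d : F) : x != 0 ->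
  (4 - 3 * x) * d = x ^+ 2 -> 4 / d = (4 / x) ^+ 2 - 3 * (4 / x).
Proof.
move=> x0 e; have : (4 - 3 * x) * d != 0 by rewrite e expf_neq0.
rewrite mulf_eq0 negb_or => /andP[x3 d0].
transitivity (4 * (4 - 3 * x) / x ^+ 2); last by field.
by rewrite -e; field; rewrite x3 d0.
Qed.

Lemma decimation_solve (F : fieldType) (x g s : F) :
  x != 0 -> 2 + x != 0 -> 4 - 3 * x != 0 -> (2 : F) != 0 ->
  (2 + x) * (4 - 3 * x) * g = (4 + x) * (2 - x) * s ->
  g = decim_factor (4 / x) * s.
Proof.
move=> x0 x1 x2 n2 e; rewrite /decim_factor.
have x12 : (2 + x) * (4 - 3 * x) != 0 by rewrite mulf_neq0.
have -> : g = (4 + x) * (2 - x) * s / ((2 + x) * (4 - 3 * x)).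
  by rewrite -e mulrAC divff ?mul1r.
have -> : 4 / x + 2 = 2 * (2 + x) / x by field.
have -> : 4 / x - 3 = (4 - 3 * x) / x by field.
by field; rewrite x0 x1 x2 n2.
Qed.

Lemma decimation_derivative (F : fieldType) (D : F -> F) (v : F) :
  (forall a b, D (a + b) = D a + D b) ->
  (forall a b, D (a * b) = D a * b + a * D b) ->
  (forall k, D k%:R = 0) -> (forall a, D (- a) = - D a) ->
  D v = - (v ^+ 2 / 4) -> v ^+ 2 - 3 * v != 0 -> (4 : F) != 0 ->
  D (4 / (v ^+ 2 - 3 * v)) = decim_deriv v.
Proof.
move=> DD DM Dn DN Dv q0 n4.
rewrite (@field_derivation_quot _ D _ _ _ DM (Dn 4) q0 erefl).
rewrite DD DN !DM Dv Dn /decim_deriv; field.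
by rewrite n4 q0.
Qed.

Lemma leibniz_sub (S : comNzRingType) (x y a b a' b' : S) :
  a * y + x * b - (a' * y + x * b') = (a - a') * y + x * (b - b').
Proof. by ring. Qed.

Lemma twisted_leibniz_sub (S : comNzRingType) (g x y a b a' b' : S) :
  a * y + x * b - g * (a' * y + x * b') = (a - g * a') * y + x * (b - g * b').
Proof. by ring. Qed.

(** * Rational functions and Laurent series compared *)

Section Assembly.
Variable R : realType.
Local Notation C := R[i].
Local Notation K := {fraction {poly C}}.
Local Notation L := (laurent C).

Definition laurent_cst (c : C) : L := (fps_cst c)%:F.
Fact laurent_cst_zmod_morphism : zmod_morphism laurent_cst.
Proof. by move=> x y; rewrite /laurent_cst !raddfB. Qed.
Fact laurent_cst_monoid_morphism : monoid_morphism laurent_cst.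
Proof. by split=> [|x y]; rewrite /laurent_cst ?rmorph1 ?rmorphM. Qed.
HB.instance Definition _ :=
  GRing.isZmodMorphism.Build _ _ laurent_cst laurent_cst_zmod_morphism.
HB.instance Definition _ :=
  GRing.isMonoidMorphism.Build _ _ laurent_cst laurent_cst_monoid_morphism.

Definition laurent_X : L := (fps_X R)%:F.
Definition laurent_v : L := 4 / laurent_X.

Lemma laurent_X_neq0 : laurent_X != 0.
Proof. by rewrite tofrac_eq0 fps_of_poly_eq0 polyX_eq0. Qed.

Lemma laurent_v_transc r : laurent_v != laurent_cst r.
Proof.
apply/eqP => /(canRL (divfK laurent_X_neq0)).
rewrite -(rmorph_nat laurent_cst) => /eqP; rewrite -tofracM tofrac_eq => /eqP.
move/fpsP/(_ 0); rewrite fps_cstM /= coefC /= coefX mulr0 => /eqP.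
by rewrite pnatr_eq0.
Qed.

Lemma frac_4X_transc r : 4 / frac_X R != frac_cst r.
Proof.
have X0 : frac_X R != 0 by have := frac_X_add R 0; rewrite addr0.
apply/eqP => /(canRL (divfK X0)); rewrite -(rmorph_nat (@frac_cst R)) => /eqP.
rewrite -tofracM tofrac_eq => /eqP/(congr1 (fun p : {poly C} => p`_0)).
by rewrite coefCM coefX coefC mulr0 => /eqP; rewrite pnatr_eq0.
Qed.

Definition iota_v : K -> L := frac_ext (@poly_ev_inj _ _ _ _ laurent_v_transc).
HB.instance Definition _ :=
  GRing.isZmodMorphism.Build _ _ iota_v (frac_ext_zmod_morphism _).
HB.instance Definition _ :=
  GRing.isMonoidMorphism.Build _ _ iota_v (frac_ext_monoid_morphism _).
(** Change of variable [t = 4/v] on the coefficients of a differential polynomial: the variable ['X]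
    is [t] in the source and [v] in the target. *)
Definition invert_X : K -> K := frac_ext (@poly_ev_inj _ _ _ _ frac_4X_transc).
HB.instance Definition _ :=
  GRing.isZmodMorphism.Build _ _ invert_X (frac_ext_zmod_morphism _).
HB.instance Definition _ :=
  GRing.isMonoidMorphism.Build _ _ invert_X (frac_ext_monoid_morphism _).

Lemma iota_v_cst c : iota_v (frac_cst c) = laurent_cst c.
Proof. by rewrite /iota_v frac_ext_tofrac; exact: poly_evC. Qed.
Lemma iota_v_X : iota_v (frac_X R) = laurent_v.
Proof. by rewrite /iota_v frac_ext_tofrac; exact: poly_evX. Qed.

Lemma invert_X_cst c : invert_X (frac_cst c) = frac_cst c.
Proof. by rewrite /invert_X frac_ext_tofrac; exact: poly_evC. Qed.
Lemma invert_X_X : invert_X (frac_X R) = 4 / frac_X R.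
Proof. by rewrite /invert_X frac_ext_tofrac; exact: poly_evX. Qed.

Lemma ratfun_laurent_invert x : ratfun_laurent x = iota_v (invert_X x).
Proof.
move: x; apply: (@frac_rmorph_eq _ _ (@ratfun_laurent C) (iota_v \o invert_X)).
have e (q : {poly C}) : ratfun_laurent q%:F = (fps_of_poly q)%:F.
  have := @ratfun_laurent_div C q 1 (oner_neq0 _).
  by rewrite rmorph1 rmorph1 !divr1.
move=> q /=; rewrite e; move: q.
apply: (@poly_rmorph_eq _ _ ((@FracField.tofrac _) \o (@fps_of_poly C))
   (iota_v \o (invert_X \o (@FracField.tofrac _)))) => [c|] /=.
  by rewrite -/(frac_cst c) invert_X_cst iota_v_cst.
rewrite -/(frac_X R) invert_X_X (fmorph_div iota_v) (rmorph_nat iota_v) /= iota_v_X.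
rewrite /laurent_v invf_div mulrC divfK //.
by rewrite -(rmorph_nat laurent_cst) fmorph_eq0 pnatr_eq0.
Qed.
Local Notation d0 := (decim_fps0 R).

Definition compose_decim : fps C -> L := (@FracField.tofrac _) \o fps_comp d0.
HB.instance Definition _ := GRing.RMorphism.on compose_decim.

Lemma compose_decim_inj : injective compose_decim.
Proof.
have inj : injective (fps_comp d0).
  apply: (@fps_comp_inj _ _ _ 1); last by case=> [|[|]].
  by rewrite /= expr0 mulr1 invr_neq0 // pnatr_eq0.
move=> x y /eqP; rewrite /compose_decim /= tofrac_eq => /eqP; exact: inj.
Qed.

Definition decim_subst : L -> L := frac_ext compose_decim_inj.
HB.instance Definition _ :=
  GRing.isZmodMorphism.Build _ _ decim_subst (frac_ext_zmod_morphism _).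
HB.instance Definition _ :=
  GRing.isMonoidMorphism.Build _ _ decim_subst (frac_ext_monoid_morphism _).

Definition laurent_der : L -> L := frac_der (@fps_deriv C).

Lemma decim_subst_tofrac a : decim_subst a%:F = (fps_comp d0 a)%:F.
Proof. by rewrite /decim_subst frac_ext_tofrac. Qed.

Lemma laurent_derM x y :
  laurent_der (x * y) = laurent_der x * y + x * laurent_der y.
Proof. exact/frac_derM/fps_derivM. Qed.

Lemma laurent_derD x y : laurent_der (x + y) = laurent_der x + laurent_der y.
Proof. exact/frac_derD/fps_derivM. Qed.

Lemma laurent_der_tofrac a : laurent_der a%:F = (fps_deriv a)%:F.
Proof. exact/frac_der_tofrac/fps_derivM. Qed.

Lemma laurent_der_cst c : laurent_der (laurent_cst c) = 0.
Proof. by rewrite laurent_der_tofrac fps_deriv_poly derivC raddf0 tofrac0. Qed.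

Lemma laurent_der_v : laurent_der laurent_v = - (laurent_v ^+ 2 / 4).
Proof.
have D4 : laurent_der 4 = 0.
  by rewrite -(rmorph_nat laurent_cst) laurent_der_cst.
rewrite (@field_derivation_quot _ _ _ _ _ laurent_derM D4 laurent_X_neq0 erefl).
rewrite -/laurent_v laurent_der_tofrac fps_deriv_poly derivX rmorph1 tofrac1.
congr (- _); rewrite mulr1 expr2 -mulrA; congr (_ * _).
rewrite /laurent_v mulrAC divff ?mul1r //.
by rewrite -(rmorph_nat laurent_cst) fmorph_eq0 pnatr_eq0.
Qed.

Lemma laurent_decimE :
  (4 - 3 * laurent_X) * (decim_fps R)%:F = laurent_X ^+ 2.
Proof.
have := congr1 (@FracField.tofrac _) (decim_fpsE R).
by rewrite tofracM tofracB tofracM !(rmorph_nat (@FracField.tofrac _)) tofracXn.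
Qed.

Lemma decim_subst_v : decim_subst laurent_v = laurent_v ^+ 2 - 3 * laurent_v.
Proof.
rewrite /laurent_v (fmorph_div decim_subst) (rmorph_nat decim_subst) /= decim_subst_tofrac fps_comp_X.
exact: decimation_inverse laurent_X_neq0 laurent_decimE.
Qed.

Lemma decim_subst_cst c : decim_subst (laurent_cst c) = laurent_cst c.
Proof.
by rewrite /laurent_cst decim_subst_tofrac fps_comp_poly /fps_horner map_polyC hornerC.
Qed.

Lemma iota_v_sg x : iota_v (quad_subst x) = decim_subst (iota_v x).
Proof.
move: x; apply: (@frac_rmorph_eq _ _ (iota_v \o @quad_subst R) (decim_subst \o iota_v)).
apply: (@poly_rmorph_eq _ _ ((iota_v \o @quad_subst R) \o (@FracField.tofrac _))
  ((decim_subst \o iota_v) \o (@FracField.tofrac _))) => [c|].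
  by rewrite /= -/(frac_cst c) quad_subst_cst !iota_v_cst decim_subst_cst.
rewrite /= -/(frac_X R) quad_subst_X (rmorphB iota_v) (rmorphXn iota_v).
by rewrite (rmorphM iota_v) (rmorph_nat iota_v) /= !iota_v_X decim_subst_v.
Qed.

Local Notation der_t := (@der_t R).

Lemma der_tM x y : der_t (x * y) = der_t x * y + x * der_t y.
Proof.
rewrite /der_t (frac_derM (@derivM C)); move: (- _) (frac_der _ _) (frac_der _ _).
by move=> a b c; rewrite mulrDr mulrA [a * (x * _)]mulrCA.
Qed.

Lemma der_tD x y : der_t (x + y) = der_t x + der_t y.
Proof. by rewrite /der_t (frac_derD (@derivM C)) mulrDr. Qed.

Lemma der_t_cst c : der_t (frac_cst c) = 0.
Proof. by rewrite /der_t (frac_der_tofrac (@derivM C)) /= derivC tofrac0 mulr0. Qed.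

Lemma der_t_X : der_t (frac_X R) = - (frac_X R ^+ 2 / 4).
Proof.
by rewrite /der_t (frac_der_tofrac (@derivM C)) /= derivX tofrac1 mulr1.
Qed.

(** The difference of the two sides satisfies the Leibniz rule along [iota_v], so it only has to
    vanish on constants and at [v]. *)
Lemma iota_v_der x : iota_v (der_t x) = laurent_der (iota_v x).
Proof.
apply/eqP; rewrite -subr_eq0; apply/eqP; move: x.
have DN y : laurent_der (- y) = - laurent_der y.
  rewrite -mulN1r laurent_derM -(rmorph1 laurent_cst) -(rmorphN laurent_cst).
  by rewrite laurent_der_cst mul0r add0r (rmorphN laurent_cst) rmorph1 mulN1r.
pose E x := iota_v (der_t x) - laurent_der (iota_v x).
have EM x y : E (x * y) = E x * iota_v y + iota_v x * E y.
  rewrite /E der_tM (rmorphD iota_v) !(rmorphM iota_v) /= laurent_derM.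
  exact: leibniz_sub.
apply: (@frac_derivation_eq0 _ _ iota_v E EM).
apply: (@poly_derivation_eq0 _ _ (iota_v \o (@FracField.tofrac _))) => [p q|p q|c|] /=.
- by rewrite /E tofracD der_tD !(rmorphD iota_v) laurent_derD opprD addrACA.
- by rewrite tofracM EM.
- rewrite -/(frac_cst c) /E der_t_cst iota_v_cst laurent_der_cst subr0.
  exact: rmorph0.
rewrite -/(frac_X R) /E der_t_X iota_v_X laurent_der_v (rmorphN iota_v).
rewrite (fmorph_div iota_v) (rmorphXn iota_v) (rmorph_nat iota_v) /= iota_v_X.
by rewrite subrr.
Qed.

Lemma der_t_nat k : der_t k%:R = 0.
Proof. by rewrite -(rmorph_nat (@frac_cst R)) der_t_cst. Qed.

Lemma der_t_opp x : der_t (- x) = - der_t x.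
Proof.
rewrite -mulN1r der_tM -(rmorph1 (@frac_cst R)) -(rmorphN (@frac_cst R)).
by rewrite der_t_cst mul0r add0r (rmorphN (@frac_cst R)) rmorph1 mulN1r.
Qed.

Local Notation v := (frac_X R).

Lemma quad_X_neq0 : v ^+ 2 - 3 * v != 0.
Proof.
have -> : v ^+ 2 - 3 * v = v * (v - 3) by rewrite mulrBr expr2 [v * 3]mulrC.
apply: mulf_neq0; last exact: (frac_X_sub R 3).
by have := frac_X_add R 0; rewrite addr0.
Qed.

(** [d] is the image of [4 / (v^2 - 3 v)], whose derivative is computed among rational functions. *)
Lemma decim_derivE : (fps_deriv (decim_fps R))%:F = iota_v (decim_deriv v).
Proof.
rewrite -laurent_der_tofrac -(decimation_derivative der_tD der_tM der_t_nat der_t_opp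
  der_t_X quad_X_neq0 (frac_char0 R 3)) iota_v_der; congr laurent_der.
rewrite (fmorph_div iota_v) (rmorph_nat iota_v) /= -quad_subst_X iota_v_sg iota_v_X.
have d00 : (decim_fps R)%:F != 0.
  rewrite tofrac_eq0; apply/eqP => /fpsP/(_ 2) /eqP.
  by rewrite /= expr0 mulr1 invr_eq0 pnatr_eq0.
have n4 : (4 : L) != 0.
  by rewrite -(rmorph_nat laurent_cst) fmorph_eq0 pnatr_eq0.
rewrite /laurent_v (fmorph_div decim_subst) (rmorph_nat decim_subst) /= decim_subst_tofrac fps_comp_X.
by rewrite invf_div mulrC divfK.
Qed.

Lemma laurent_der_sg x :
  laurent_der (decim_subst x) = iota_v (decim_deriv v) * decim_subst (laurent_der x).
Proof.
apply/eqP; rewrite -subr_eq0; apply/eqP; move: x.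
pose E x := laurent_der (decim_subst x) - iota_v (decim_deriv v) * decim_subst (laurent_der x).
apply: (@frac_derivation_eq0 _ _ decim_subst E) => [x y|x].
  rewrite /E laurent_derM (rmorphM decim_subst) laurent_derM (rmorphD decim_subst).
  rewrite (rmorphM decim_subst (laurent_der x) y) (rmorphM decim_subst x (laurent_der y)).
  exact: twisted_leibniz_sub.
rewrite /E decim_subst_tofrac !laurent_der_tofrac decim_subst_tofrac fps_deriv_comp tofracM.
by rewrite decim_derivE subrr.
Qed.

Lemma der_t_sg x : der_t (quad_subst x) = decim_deriv v * quad_subst (der_t x).
Proof.
apply: (fmorph_inj iota_v).
change (iota_v (der_t (quad_subst x)) = iota_v (decim_deriv v * quad_subst (der_t x))).
rewrite iota_v_der iota_v_sg laurent_der_sg -iota_v_der -iota_v_sg.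
exact: esym (rmorphM iota_v _ _).
Qed.

Lemma return_gf_sg :
  (return_gf R)%:F = iota_v (decim_factor v) * decim_subst (return_gf R)%:F.
Proof.
have c0 (b c : C) : c != 0 -> laurent_cst c + laurent_cst b * laurent_X != 0.
  move=> n0; rewrite -tofracM -tofracD tofrac_eq0; apply/eqP => /fpsP/(_ 0) /eqP.
  by rewrite fps_coefD fps_cstM /= coefC coefX mulr0 addr0 (negPf n0).
have -> : iota_v (decim_factor v) = decim_factor laurent_v.
  rewrite /decim_factor (fmorph_div iota_v) !(rmorphM iota_v) !(rmorphD iota_v).
  by rewrite !(rmorphN iota_v) !(rmorph_nat iota_v) rmorph1 /= iota_v_X.
apply: decimation_solve laurent_X_neq0 _ _ _ _.
- have := @c0 1 2; rewrite pnatr_eq0 rmorph1 mul1r (rmorph_nat laurent_cst).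
  exact.
- have := @c0 (- 3) 4; rewrite pnatr_eq0 (rmorphN laurent_cst) mulNr.
  by rewrite !(rmorph_nat laurent_cst); apply.
- by rewrite -(rmorph_nat laurent_cst) fmorph_eq0 pnatr_eq0.
have := congr1 (@FracField.tofrac _) (return_gfE R).
rewrite decim_subst_tofrac.
by rewrite !(rmorph_nat (@FracField.tofrac (fps C)), tofracM, tofracD, tofracN).
Qed.

Lemma iter_laurent_der k (f : fps C) :
  (iter k (@fps_deriv C) f)%:F = iter k laurent_der f%:F.
Proof. by elim: k => //= k IH; rewrite -IH laurent_der_tofrac. Qed.

Lemma mmap_invert_X n (h : 'I_n -> L) (P : {mpoly K[n]}) :
  mmap (@ratfun_laurent C) h P = mmap iota_v h (map_mpoly invert_X P).
Proof.
elim/mpoly_gen_ind: P => [c|i|P Q e1 e2|P Q e1 e2].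
- by rewrite map_mpolyC ?rmorph0 // !mmapC; exact: ratfun_laurent_invert.
- by rewrite map_mpolyX !mmapX.
- by rewrite !rmorphD /= e1 e2.
- by rewrite !rmorphM /= e1 e2.
Qed.
End Assembly.

Theorem theorem1p3 (R : realType) : @diff_transcendental R[i] (return_gf R).
Proof.
case=> n [P [P0]]; rewrite /diff_eval mmap_invert_X.
have char0 := frac_char0 R; have v_add := frac_X_add R; have v_sub := frac_X_sub R.
have v_half := frac_X_half R; have sgv := quad_subst_X R.
have no_prim := @decim_no_primitive _ _ _ _ char0 v_add v_sub v_half sgv
  (@der_tD R) (@der_tM R) (der_t_X R) (@frac_no_residue R).
have twf := @decim_twist_factor _ _ _ _ char0 v_add v_sub v_half sgv
  (@der_tD R) (@der_tM R) (der_t_X R) (@der_t_sg R) (@frac_no_residue R).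
have twd := @decim_twist_deriv _ _ _ v_add v_sub sgv (@frac_no_twist R).
have dp0 := decim_deriv_neq0 v_add v_sub v_half.
have f0 := decim_factor_neq0 v_add v_sub.
have G0 : (return_gf R)%:F != 0 by rewrite tofrac_eq0 return_gf_neq0.
have mP0 : map_mpoly (@invert_X R) P != 0.
  apply: contraNneq P0 => /(congr1 (mcoeff (mlead P))) /eqP.
  by rewrite mcoeff_map_mpoly mcoeff0 fmorph_eq0 mleadc_eq0.
have := @der_transcendental _ _ (@iota_v R) (@quad_subst R) (@decim_subst R) (@der_t R)
  (@laurent_der R) _ _ _ char0 dp0 f0 G0 (@der_tM R) (@laurent_derD R)
  (@laurent_derM R) (@iota_v_sg R) (@iota_v_der R) (@laurent_der_sg R)
  (return_gf_sg R) twd twf no_prim n (map_mpoly (@invert_X R) P) mP0.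
have -> : (fun i : 'I_n.+1 => iter i (@laurent_der R) (return_gf R)%:F) =
    (fun i : 'I_n.+1 => (iter i (@fps_deriv R[i]) (return_gf R))%:F).
  by apply: boolp.funext => i; rewrite iter_laurent_der.
by move=> /eqP.
Qed.
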